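(* Let $X$ be a filtered chain complex and let $\mathcal G$ be a totally ordered quasi-minimal set of generators of $X$, labelled by degree and entrance time. Then the interval sphere decomposition algorithm described in the context, applied to $\mathcal{G}$, terminates and returns a finite list of interval spheres whose direct sum is isomorphic to $X$. Hence, forgetting the intervals of length zero, it also yields for each $n$ the barcode decomposition of the persistence module $H_nX$: $H_nX\cong\bigoplus \mathbb{I}_{[s,e)}$, the sum being over the entries $I^n[s,e)$ of dimension $n$ in the list (with multiplicity) with $s<e$.
   Context: $\mathbb{F}$ is a finite prime field. Chain complexes are non-negatively graded complexes of $\mathbb{F}$-vector spaces and are assumed compact, i.e. $\bigoplus_n C_n$ is finite dimensional; $\mathbf{ch}$ is the category of these. A functor $X\colon[0,\infty)\to\mathbf{ch}$ has values $X^t$ and transition morphisms $X^{s\le t}\colon X^s\to X^t$; $X_n^t$ is the degree $n$ part of $X^t$; $\delta$ denotes the differential of $X$. $X$ is tame if there is a finite sequence $0=\tau_0<\dots<\tau_k$ such that $X^{s\le t}$ may fail to be an isomorphism only when $s<\tau_a\le t$ for some $a\in\{1,\dots,k\}$. A filtered chain complex is a tame $X$ all of whose transition morphisms are monomorphisms. $H_nX$ is the functor $t\mapsto H_n(X^t)$. $\mathbb{I}_{[s,e)}$ is the interval module: $\mathbb{F}$ for $t\in[s,e)$, $0$ otherwise, with identity transition maps inside $[s,e)$. Interval spheres: $S^n$ is the complex equal to $\mathbb{F}$ in degree $n$ and $0$ elsewhere; $D^{n+1}$ is the complex equal to $\mathbb{F}$ in degrees $n+1$ and $n$, with identity differential between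 them, and $0$ elsewhere. For $n\in\mathbb{N}$, $0\le s<\infty$ and $s\le e\le\infty$, the interval sphere $I^n[s,e)$ is the filtered chain complex (up to isomorphism) with $I^n[s,e)^t=0$ for $t<s$, $S^n$ for $s\le t<e$, $D^{n+1}$ for $e\le t<\infty$, with transition morphisms the evident inclusions $0\hookrightarrow S^n\hookrightarrow D^{n+1}$ and identities. (The case $s=e<\infty$ is allowed.) Generators: each generator $x$ has a degree $\deg(x)=n$ and an entrance time $\mathrm{ent}(x)=t$, with $x\in X_n^t$; a finite set $\mathcal G$ of such elements generates $X$ if the elements, their images under transition morphisms, and the differentials of these span every $X_n^t$ (equivalently, the induced morphism $\bigoplus_{x\in\mathcal G} I^{\deg(x)-1}[\mathrm{ent}(x),\mathrm{ent}(x))\to X$ is an epimorphism, where $I^{-1}[s,s)$ means $I^0[s,\infty)$). The radical $\mathrm{rad}X_n\subset X_n$ has value at $t$ the sum of the images of $X_n^{s<t}$ over all $s<t$. $\mathcal G$ is quasi-minimal if for all $n$ and $t$ the set $\{x\in\mathcal G: \mathrm{ent}(x)=t,\ \deg(x)=n\}$ is (maps bijectively onto) a basis of $(X_n/\mathrm{rad}X_n)^t$. Then, for each $n,t$, the images in $X_n^t$ of the generators of degree $n$ and entrance time $\le t$ form a basis of $X_n^t$. Since transition morphisms are injective, elements are identified with their images under them. Total boundary matrix: for $\mathcal G=\{x_1,\dots,x_m\}$ quasi-minimal (with an arbitrary total order), $d=(d^i_j)$ is the $m\times m$ matrix determined by $\delta(x_j)=\sum_{i} d^i_j x_i$. Superscripts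 are row indices, subscripts column indices; $d^i$ is the $i$-th row. Row and column $i$ carry the labels $\deg(i)=\deg(x_i)$, $\mathrm{ent}(i)=\mathrm{ent}(x_i)$, and these labels are kept when other rows and columns are deleted. Algorithm. Input: $\mathcal G$. Start with the empty list and with $d$ the total boundary matrix of $X$ with respect to $\mathcal G$. While there is an index $i$ with $d^i\ne0$: choose such an $i$; set $(i,j)=\mathtt{PAIR}(d,i)$; append $I^{\deg(i)}[\mathrm{ent}(i),\mathrm{ent}(j))$ to the list; replace $d$ by $\mathtt{SPLIT}(i,j,d)$. When $d=0$, for every index $i$ of a remaining row append $I^{\deg(i)}[\mathrm{ent}(i),\infty)$ to the list. Return the list. $\mathtt{PAIR}(d,i)$ (where $d^i\neq0$): pick $j\in\arg\min_{h\mid d^i_h\ne0}\mathrm{ent}(h)$. Then repeat the following: if $i\in\arg\max_{h\mid d^h_j\ne0}\mathrm{ent}(h)$, return $(i,j)$; otherwise replace $i$ by some element of $\arg\max_{h\mid d^h_j\ne0}\mathrm{ent}(h)$; then, if $j\in\arg\min_{h\mid d^i_h\ne0}\mathrm{ent}(h)$, return $(i,j)$; otherwise replace $j$ by some element of $\arg\min_{h\mid d^i_h\ne0}\mathrm{ent}(h)$. $\mathtt{SPLIT}(i,j,d)$: for each $k$ with $d^k_j\ne0$ add to the $k$-th row the $i$-th row (as it was before this step) multiplied by $-(d^i_j)^{-1}d^k_j$; then delete rows $i$ and $j$ and columns $i$ and $j$. All choices in the algorithm are arbitrary. *)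

(* Defs.v *)
From HB Require Import structures.
From Stdlib Require Import Relation_Operators Lia.
From mathcomp Require Import all_boot all_order all_algebra.
From mathcomp Require Import generic_quotient ring_quotient interval_inference.
From mathcomp Require Import boolp reals.

Set Implicit Arguments.
Unset Strict Implicit.
Unset Printing Implicit Defensive.

Import Order.TTheory GRing.Theory Num.Theory.
Local Open Scope ring_scope.
Local Open Scope quotient_scope.

(** * Quotient vector spaces *)

Section QuotientSpace.
Variables (F : fieldType) (V : vectType F).

Definition quotv (U : {vspace V}) : Type := Quotient.quot (pred_of_vspace U).

Section Instances.
Variable U : {vspace V}.

HB.instance Definition _ := Choice.on (quotv U).
HB.instance Definition _ := GRing.Zmodule.on (quotv U).

Definition class (v : V) : quotv U := \pi_(Quotient.quot (pred_of_vspace U)) v.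
Definition class_repr (q : quotv U) : V := repr (q : Quotient.quot (pred_of_vspace U)).

Lemma class_reprK q : class (class_repr q) = q.
Proof. exact: reprK. Qed.

Lemma classP v w : class v = class w <-> v - w \in U.
Proof.
rewrite /class; split=> [/eqP|h]; first by rewrite -Quotient.idealrBE.
by apply/eqP; rewrite -Quotient.idealrBE.
Qed.

Lemma classD v w : class (v + w) = class v + class w.
Proof. exact: raddfD. Qed.

Definition quotv_scale (a : F) (q : quotv U) : quotv U := class (a *: class_repr q).

Lemma class_scale a v : quotv_scale a (class v) = class (a *: v).
Proof.
rewrite /quotv_scale; apply/classP; rewrite -scalerBr; apply: rpredZ.
by apply/classP; rewrite class_reprK.
Qed.

Fact quotv_scaleA a b q : quotv_scale a (quotv_scale b q) = quotv_scale (a * b) q.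
Proof. by rewrite -(class_reprK q) !class_scale scalerA. Qed.
Fact quotv_scale1 : left_id 1 quotv_scale.
Proof. by move=> q; rewrite -(class_reprK q) class_scale scale1r. Qed.
Fact quotv_scaleDr : right_distributive quotv_scale +%R.
Proof.
move=> a q r; rewrite -(class_reprK q) -(class_reprK r) -classD !class_scale.
by rewrite -classD scalerDr.
Qed.
Fact quotv_scaleDl q : {morph quotv_scale^~ q : a b / a + b}.
Proof. by move=> a b; rewrite -(class_reprK q) !class_scale -classD scalerDl. Qed.

HB.instance Definition _ := GRing.Zmodule_isLmodule.Build F (quotv U)
  quotv_scaleA quotv_scale1 quotv_scaleDr quotv_scaleDl.

Lemma classZ a v : class (a *: v) = a *: class v.
Proof. by rewrite -class_scale. Qed.

Fact class_is_linear : linear class.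
Proof. by move=> a v w; rewrite classD classZ. Qed.
HB.instance Definition _ := GRing.isLinear.Build F V (quotv U) _ class class_is_linear.

(* The quotient is finite dimensional: it is isomorphic to a complement of U. *)
Fact quotv_vect_axiom : Vector.axiom (\dim U^C) (quotv U).
Proof.
pose g (w : subvs_of U^C) : quotv U := class (vsval w).
have gl : linear g by move=> a v w; rewrite /g [vsval _]linearP linearP.
have ginj : injective g.
  move=> v w /classP vw; apply: val_inj => /=; apply/eqP; rewrite -subr_eq0.
  rewrite -memv0 -(capv_compl U) memv_cap vw.
  by rewrite rpredB // subvsP.
have gsur q : exists w, g w = q.
  have : class_repr q \in (U + U^C)%VS by rewrite addv_complf memvf.
  case/memv_addP=> u uU [w wU e]; exists (Subvs wU); rewrite /g /=.
  rewrite -[RHS]class_reprK; apply/classP.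
  by rewrite e opprD addrCA subrr addr0 rpredN.
pose h q := xchoose (ex_intro (fun w => g w == q) _ (introT eqP (projT2 (cid (gsur q))))).
have hK : cancel h g by move=> q; apply/eqP/(xchooseP (ex_intro (fun w => g w == q) _ _)).
have gK : cancel g h by move=> w; apply: ginj; rewrite hK.
have hl : linear h by move=> a v w; apply: ginj; rewrite gl !hK.
have [f fl fb] := subvs_vect_iso (U^C)%VS.
exists (f \o h); first by move=> a v w /=; rewrite hl fl.
by apply: bij_comp => //; exists g.
Qed.
HB.instance Definition _ := Lmodule_hasFinDim.Build F (quotv U) quotv_vect_axiom.

End Instances.
End QuotientSpace.

(* The map V / U -> W / U' induced by f; meaningful when f maps U into U'. *)
Definition quotv_map (F : fieldType) (V W : vectType F) (U : {vspace V})
    (U' : {vspace W}) (f : 'Hom(V, W)) : 'Hom(quotv U, quotv U') :=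
  linfun (fun q => class U' (f (class_repr q))).

Lemma quotv_mapE (F : fieldType) (V W : vectType F) (U : {vspace V})
    (U' : {vspace W}) (f : 'Hom(V, W)) :
  (f @: U <= U')%VS -> forall v, quotv_map U U' f (class U v) = class U' (f v).
Proof.
move=> fU.
pose g q := class U' (f (class_repr (q : quotv U))).
have gE v : g (class U v) = class U' (f v).
  apply/classP; rewrite -linearB; apply: (subvP fU); apply: memv_img.
  by apply/classP; rewrite class_reprK.
have gl : linear g.
  move=> a v w; rewrite -(class_reprK v) -(class_reprK w) -linearP !gE.
  by rewrite !linearP.
pose gL : {linear quotv U -> quotv U'} := HB.pack g (GRing.isLinear.Build _ _ _ _ g gl).
by move=> v; rewrite -gE -[RHS](lfunE gL).
Qed.

(* Any linear condition on a finite dimensional space cuts out a subspace. *)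
Lemma vspace_of_prop (F : fieldType) (V : vectType F) (P : V -> Prop) :
  P 0 -> (forall (a : F) u v, P u -> P v -> P (a *: u + v)) ->
  exists U : {vspace V}, forall v, v \in U <-> P v.
Proof.
move=> P0 PD.
have ext k : forall U : {vspace V}, (\dim {:V} - \dim U <= k)%N ->
    (forall v, v \in U -> P v) -> exists U : {vspace V}, forall v, v \in U <-> P v.
  elim: k => [|k IHk] U dU UP.
    exists U => v; split=> [/UP //|_].
    have /eqP-> : U == fullv by rewrite eqEdim subvf -subn_eq0 -leqn0.
    exact: memvf.
  have [all|/existsNP[v /not_implyP[Pv /negP vU]]] := pselect (forall v, P v -> v \in U).
    by exists U => v; split=> [/UP|/all].
  apply: (IHk (<[v]> + U)%VS) => [|w]; last first.
    by case/memv_addP=> _ /vlineP[a ->] [u /UP Pu ->]; apply: PD.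
  have lt : (\dim U < \dim (<[v]> + U))%N.
    rewrite ltn_neqAle dimvS ?addvSr // andbT; apply: contra vU => /eqP e.
    have /eqP-> : U == (<[v]> + U)%VS by rewrite eqEdim addvSr e leqnn.
    by rewrite (subvP (addvSl _ _)) // memv_line.
  move: dU; rewrite !leq_subLR addnS => /leq_trans; apply.
  by rewrite -ltnS ltnS -addSn leq_add2r.
apply: (ext (\dim {:V}) 0%VS); first exact: leq_subr.
by move=> v; rewrite memv0 => /eqP->.
Qed.

(** * Chain complexes *)

Section Complexes.
Variable F : fieldType.

(* [diff n] goes from degree n.+1 to degree n; the last field, together with
   vectType being finite dimensional, is compactness. *)
Record chcomplex := ChComplex {
  cobj :> nat -> vectType F;
  diff : forall n, 'Hom(cobj n.+1, cobj n);
  diff2 : forall n, (diff n \o diff n.+1)%VF = 0;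
  cbounded : exists N, forall n, (N <= n)%N -> \dim {:cobj n} = 0%N }.

Record chmap (C D : chcomplex) := ChMap {
  cmap :> forall n, 'Hom(C n, D n);
  cmapP : forall n, (cmap n \o diff C n = diff D n \o cmap n.+1)%VF }.

Definition chmap_iso C D (f : chmap C D) : Prop :=
  exists g : chmap D C, (forall n, cancel (f n) (g n)) /\ (forall n, cancel (g n) (f n)).

Definition chmap_mono C D (f : chmap C D) : Prop := forall n, injective (f n).

Definition cycles (C : chcomplex) n : {vspace C n} :=
  match n with 0 => fullv | k.+1 => lker (diff C k) end.

Definition boundaries (C : chcomplex) n : {vspace subvs_of (cycles C n)} :=
  (linfun vsval @^-1: limg (diff C n))%VS.

Definition homology (C : chcomplex) n : vectType F := quotv (boundaries C n).

Definition cycles_map C D (f : chmap C D) n :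
    'Hom(subvs_of (cycles C n), subvs_of (cycles D n)) :=
  (linfun (vsproj (cycles D n)) \o f n \o linfun vsval)%VF.

Definition homology_map C D (f : chmap C D) n : 'Hom(homology C n, homology D n) :=
  quotv_map (boundaries C n) (boundaries D n) (cycles_map f n).

Lemma cmapE C D (f : chmap C D) n x : f n (diff C n x) = diff D n (f n.+1 x).
Proof. by have /lfunP/(_ x) := cmapP f n; rewrite !comp_lfunE. Qed.

Lemma cycles_mapE C D (f : chmap C D) n z : vsval (cycles_map f n z) = f n (vsval z).
Proof.
rewrite /cycles_map !comp_lfunE !lfunE /= vsprojK //.
case: n z => [|n] z; first exact: memvf.
by rewrite memv_ker -cmapE; have := subvsP z; rewrite memv_ker => /eqP->; rewrite linear0.
Qed.

Lemma homology_mapE C D (f : chmap C D) n z :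
  homology_map f n (class _ z) = class (boundaries D n) (cycles_map f n z).
Proof.
apply: quotv_mapE; apply/subvP=> _ /memv_imgP[w wB ->].
have E1 U (V : {vspace U}) (y : subvs_of V) : linfun vsval y = vsval y :> U by exact: lfunE.
move: wB; rewrite -!memv_preim !E1 cycles_mapE => /memv_imgP[x _ ->].
by rewrite cmapE memv_img // memvf.
Qed.

End Complexes.

(** * Functors indexed by [0, oo) *)

Section Functors.
Variables (R : realType) (F : fieldType).
Local Notation T := {nonneg R}.

Record chfunctor := ChFunctor {
  fobj :> T -> chcomplex F;
  ftr : forall s t : T, s <= t -> chmap (fobj s) (fobj t);
  ftr_id : forall (t : T) (h : t <= t) n x, ftr h n x = x;
  ftr_comp : forall (r s t : T) (hrs : r <= s) (hst : s <= t) (hrt : r <= t) n x,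
    ftr hrt n x = ftr hst n (ftr hrs n x) }.

Definition tame (X : chfunctor) : Prop :=
  exists taus : seq T, path <%R 0%:nng taus /\
    forall (s t : T) (h : s <= t),
      ~~ has (fun a => (s < a) && (a <= t)) taus -> chmap_iso (ftr X h).

Definition filtered (X : chfunctor) : Prop :=
  tame X /\ forall (s t : T) (h : s <= t), chmap_mono (ftr X h).

Definition chfunctor_iso (X Y : chfunctor) : Prop :=
  exists f : forall t, chmap (X t) (Y t),
    (forall (s t : T) (h : s <= t) n x, f t n (ftr X h n x) = ftr Y h n (f s n x)) /\
    (forall t, chmap_iso (f t)).

Record persmod := PersMod {
  pobj :> T -> vectType F;
  ptr : forall s t : T, s <= t -> 'Hom(pobj s, pobj t);
  ptr_id : forall (t : T) (h : t <= t) x, ptr h x = x;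
  ptr_comp : forall (r s t : T) (hrs : r <= s) (hst : s <= t) (hrt : r <= t) x,
    ptr hrt x = ptr hst (ptr hrs x) }.

Definition persmod_iso (M N : persmod) : Prop :=
  exists f : forall t, 'Hom(M t, N t),
    (forall (s t : T) (h : s <= t) x, f t (ptr M h x) = ptr N h (f s x)) /\
    (forall t, bijective (f t)).

Section HomologyFunctor.
Variables (X : chfunctor) (n : nat).

Fact homology_tr_id (t : T) (h : t <= t) (q : homology (X t) n) :
  homology_map (ftr X h) n q = q.
Proof.
rewrite -[q]class_reprK homology_mapE; congr class.
by apply: subvs_inj; rewrite cycles_mapE ftr_id.
Qed.

Fact homology_tr_comp (r s t : T) (hrs : r <= s) (hst : s <= t) (hrt : r <= t)
    (q : homology (X r) n) :
  homology_map (ftr X hrt) n q =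
  homology_map (ftr X hst) n (homology_map (ftr X hrs) n q).
Proof.
rewrite -[q]class_reprK !homology_mapE; congr class.
by apply: subvs_inj; rewrite !cycles_mapE; apply: ftr_comp.
Qed.

Definition homology_functor : persmod := PersMod homology_tr_id homology_tr_comp.
End HomologyFunctor.

(** ** Direct sums *)

Definition lfun_pair (V V' W W' : vectType F) (f : 'Hom(V, V')) (g : 'Hom(W, W')) :
    'Hom((V * W)%type, (V' * W')%type) :=
  linfun (fun x : V * W => (f x.1, g x.2)).

Lemma lfun_pairE (V V' W W' : vectType F) (f : 'Hom(V, V')) (g : 'Hom(W, W')) x :
  lfun_pair f g x = (f x.1, g x.2).
Proof.
pose k (y : V * W) := (f y.1, g y.2).
have kl : linear k by move=> a y z; rewrite /k /= !linearP.
pose kL : {linear (V * W)%type -> (V' * W')%type} :=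
  HB.pack k (GRing.isLinear.Build _ _ _ _ k kl).
exact: (lfunE kL).
Qed.

Section Sum2.
Variables C D : chcomplex F.

Definition sum2_obj n : vectType F := (C n * D n)%type.
Definition sum2_diff n : 'Hom(sum2_obj n.+1, sum2_obj n) :=
  lfun_pair (diff C n) (diff D n).
Fact sum2_diff2 n : (sum2_diff n \o sum2_diff n.+1)%VF = 0.
Proof.
apply/lfunP=> x; rewrite comp_lfunE zero_lfunE !lfun_pairE /=.
by rewrite -!comp_lfunE !diff2 !zero_lfunE.
Qed.
Fact sum2_bounded : exists N, forall n, (N <= n)%N -> \dim {:sum2_obj n} = 0%N.
Proof.
have [N1 h1] := cbounded C; have [N2 h2] := cbounded D.
exists (N1 + N2)%N => n hn.
have := h1 n (leq_trans (leq_addr _ _) hn); have := h2 n (leq_trans (leq_addl _ _) hn).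
rewrite !dimvf => hD hC; have -> : dim (sum2_obj n) = (dim (C n) + dim (D n))%N by [].
by rewrite hC hD.
Qed.
Definition sum2_ch := ChComplex sum2_diff2 sum2_bounded.
End Sum2.

Section Sum2Map.
Variables (C C' D D' : chcomplex F) (f : chmap C C') (g : chmap D D').

Definition sum2_cmap n : 'Hom(sum2_ch C D n, sum2_ch C' D' n) := lfun_pair (f n) (g n).
Fact sum2_cmapP n :
  (sum2_cmap n \o diff (sum2_ch C D) n = diff (sum2_ch C' D') n \o sum2_cmap n.+1)%VF.
Proof. by apply/lfunP=> x; rewrite !comp_lfunE !lfun_pairE /= !cmapE. Qed.
Definition sum2_chmap := ChMap sum2_cmapP.
End Sum2Map.

Section Sum2Functor.
Variables X Y : chfunctor.
Definition sum2_tr (s t : T) (h : s <= t) : chmap (sum2_ch (X s) (Y s)) (sum2_ch (X t) (Y t)) :=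
  sum2_chmap (ftr X h) (ftr Y h).
Fact sum2_tr_id (t : T) (h : t <= t) n x : sum2_tr h n x = x.
Proof. by rewrite /= lfun_pairE !ftr_id -surjective_pairing. Qed.
Fact sum2_tr_comp (r s t : T) (hrs : r <= s) (hst : s <= t) (hrt : r <= t) n x :
  sum2_tr hrt n x = sum2_tr hst n (sum2_tr hrs n x).
Proof. by rewrite /= !lfun_pairE /= -!ftr_comp. Qed.
Definition sum2_functor : chfunctor := ChFunctor sum2_tr_id sum2_tr_comp.
End Sum2Functor.

Section Zero.
Definition zero_obj (n : nat) : vectType F := 'rV[F]_0.
Definition zero_diff n : 'Hom(zero_obj n.+1, zero_obj n) := 0.
Fact zero_diff2 n : (zero_diff n \o zero_diff n.+1)%VF = 0.
Proof. exact: comp_lfun0l. Qed.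
Fact zero_bounded : exists N, forall n, (N <= n)%N -> \dim {:zero_obj n} = 0%N.
Proof. by exists 0%N => n _; rewrite dimvf. Qed.
Definition zero_ch := ChComplex zero_diff2 zero_bounded.
Fact zero_cmapP n :
  ((\1%VF : 'Hom(zero_ch n, zero_ch n)) \o diff zero_ch n = diff zero_ch n \o \1)%VF.
Proof. by rewrite comp_lfun1l comp_lfun1r. Qed.
Definition zero_tr (s t : T) (h : s <= t) : chmap zero_ch zero_ch := ChMap zero_cmapP.
Fact zero_tr_id (t : T) (h : t <= t) n x : zero_tr h n x = x.
Proof. exact: id_lfunE. Qed.
Fact zero_tr_comp (r s t : T) (hrs : r <= s) (hst : s <= t) (hrt : r <= t) n x :
  zero_tr hrt n x = zero_tr hst n (zero_tr hrs n x).
Proof. by rewrite /= !id_lfunE. Qed.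
Definition zero_functor : chfunctor := ChFunctor zero_tr_id zero_tr_comp.

Fact zerop_tr_id (t : T) (h : t <= t) (x : 'rV[F]_0) : (\1%VF : 'End('rV[F]_0)) x = x.
Proof. exact: id_lfunE. Qed.
Fact zerop_tr_comp (r s t : T) (hrs : r <= s) (hst : s <= t) (hrt : r <= t) (x : 'rV[F]_0) :
  (\1%VF : 'End('rV[F]_0)) x = (\1%VF : 'End('rV[F]_0)) ((\1%VF : 'End('rV[F]_0)) x).
Proof. by rewrite !id_lfunE. Qed.
Definition zero_persmod : persmod :=
  @PersMod (fun=> 'rV[F]_0) (fun _ _ _ => \1%VF) zerop_tr_id zerop_tr_comp.
End Zero.

Section Sum2PersMod.
Variables M N : persmod.
Definition sum2p_tr (s t : T) (h : s <= t) : 'Hom((M s * N s)%type, (M t * N t)%type) :=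
  lfun_pair (ptr M h) (ptr N h).
Fact sum2p_tr_id (t : T) (h : t <= t) x : sum2p_tr h x = x.
Proof. by rewrite lfun_pairE !ptr_id -surjective_pairing. Qed.
Fact sum2p_tr_comp (r s t : T) (hrs : r <= s) (hst : s <= t) (hrt : r <= t) x :
  sum2p_tr hrt x = sum2p_tr hst (sum2p_tr hrs x).
Proof. by rewrite !lfun_pairE /= -!ptr_comp. Qed.
Definition sum2_persmod : persmod :=
  @PersMod (fun t => (M t * N t)%type) sum2p_tr sum2p_tr_id sum2p_tr_comp.
End Sum2PersMod.

Definition sum_functor (Xs : seq chfunctor) : chfunctor :=
  foldr sum2_functor zero_functor Xs.
Definition sum_persmod (Ms : seq persmod) : persmod :=
  foldr sum2_persmod zero_persmod Ms.

(** ** Interval spheres and interval modules *)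

(* For bits b and c, ['rV[F]_b] is F or 0, and [bitmap b c] is the identity
   of F if b and c are both true, and the zero map otherwise. *)
Definition bitmap (b c : bool) : 'Hom('rV[F]_b, 'rV[F]_c) :=
  linfun (mulmxr (pid_mx 1)).

Lemma bitmap_id (b : bool) (x : 'rV[F]_b) : bitmap b b x = x.
Proof.
rewrite lfunE /=; case: b x => x; first by rewrite pid_mx_1 mulmx1.
by rewrite [LHS]thinmx0 [RHS]thinmx0.
Qed.

Lemma bitmap_comp (b c d : bool) (x : 'rV[F]_b) : (b && d ==> c) ->
  bitmap c d (bitmap b c x) = bitmap b d x.
Proof.
case: b x => x h; last by rewrite (thinmx0 x) !linear0.
case: d h => h; last by rewrite [LHS]thinmx0 [RHS]thinmx0.
by case: c h => // _; rewrite !bitmap_id.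
Qed.

Lemma bitmap0 (b c : bool) (x : 'rV[F]_b) : ~~ (b && c) -> bitmap b c x = 0.
Proof.
case: b x => x; last by rewrite (thinmx0 x) !linear0.
by case: c => // _; rewrite [LHS]thinmx0 [RHS]thinmx0.
Qed.

(* Endpoints e in [0, oo], with [None] standing for oo. *)
Definition ended (e : option T) (t : T) : bool := if e is Some e' then e' <= t else false.
Definition le_end (s : T) (e : option T) : bool := if e is Some e' then s <= e' else true.
Definition lt_end (s : T) (e : option T) : bool := if e is Some e' then s < e' else true.

(* The name of the interval sphere I^n[s, e); it is one only if [le_end s e]. *)
Record bar := Bar { bdeg : nat; bstart : T; bend : option T }.

Section IntervalSphere.
Variable b : bar.

(* Whether I^n[s, e) is F (rather than 0) at time t in degree m: 0 for t < s, S^n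
   for s <= t < e and D^{n+1} for e <= t. If s <= e, the conjunct
   [bstart b <= t] in the second disjunct is redundant; it ensures that the
   construction below also makes sense without this condition. *)
Definition isphere_bit (t : T) (m : nat) : bool :=
  (m == bdeg b) && (bstart b <= t) ||
  (m == (bdeg b).+1) && (bstart b <= t) && ended (bend b) t.

Definition isphere_obj t m : vectType F := 'rV[F]_(isphere_bit t m).
Definition isphere_diff t m : 'Hom(isphere_obj t m.+1, isphere_obj t m) :=
  bitmap (isphere_bit t m.+1) (isphere_bit t m).

Lemma isphere_bit_deg t m : isphere_bit t m -> (m == bdeg b) || (m == (bdeg b).+1).
Proof. by case/orP=> [/andP[-> //]|/andP[/andP[-> _] _]]; rewrite orbT. Qed.

Fact isphere_diff2 t m : (isphere_diff t m \o isphere_diff t m.+1)%VF = 0.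
Proof.
apply/lfunP=> x; rewrite comp_lfunE zero_lfunE.
have [b2|b2] := boolP (isphere_bit t m.+2 && isphere_bit t m.+1); last first.
  by rewrite [isphere_diff t m.+1 x]bitmap0 ?linear0.
apply: bitmap0; apply/negP => /andP[_ b0]; case/andP: b2 => b2 _.
have := isphere_bit_deg b2; have := isphere_bit_deg b0.
by move=> /orP[]/eqP e0 /orP[]/eqP e2; lia.
Qed.

Fact isphere_bounded t : exists N, forall n, (N <= n)%N -> \dim {:isphere_obj t n} = 0%N.
Proof.
exists (bdeg b).+2 => n hn; rewrite dimvf /dim /= /isphere_bit.
by rewrite gtn_eqF 1?gtn_eqF // ltnW.
Qed.

Definition isphere_ch t : chcomplex F := ChComplex (isphere_diff2 t) (isphere_bounded t).

Lemma isphere_bit_le (s t : T) m : s <= t -> isphere_bit s m -> isphere_bit t m.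
Proof.
move=> st; rewrite /isphere_bit => /orP[/andP[-> h]|/andP[/andP[-> h] h']].
  by rewrite (le_trans h st).
rewrite (le_trans h st) /=; case: (bend b) h' => //= e h'.
by rewrite (le_trans h' st) orbT.
Qed.

Section Transition.
Variables (s t : T) (h : s <= t).
Definition isphere_cmap m : 'Hom(isphere_ch s m, isphere_ch t m) :=
  bitmap (isphere_bit s m) (isphere_bit t m).
Fact isphere_cmapP m :
  (isphere_cmap m \o diff (isphere_ch s) m = diff (isphere_ch t) m \o isphere_cmap m.+1)%VF.
Proof.
apply/lfunP=> x; rewrite !comp_lfunE /= /isphere_diff /isphere_cmap.
rewrite !bitmap_comp //; apply/implyP => /andP[h1 h2].
  exact: isphere_bit_le h1.
move: h1 h2; rewrite /isphere_bit eqSS.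
have [<-|_] := eqVneq m.+1 (bdeg b).
  by rewrite [m == _]ltn_eqF // [m == _]ltn_eqF // ltnS leqnSn.
by have [->|//] := eqVneq m (bdeg b); rewrite /= => /andP[-> _].
Qed.
Definition isphere_tr : chmap (isphere_ch s) (isphere_ch t) := ChMap isphere_cmapP.
End Transition.

Fact isphere_tr_id (t : T) (h : t <= t) n x : isphere_tr h n x = x.
Proof. exact: bitmap_id. Qed.
Fact isphere_tr_comp (r s t : T) (hrs : r <= s) (hst : s <= t) (hrt : r <= t) n x :
  isphere_tr hrt n x = isphere_tr hst n (isphere_tr hrs n x).
Proof.
rewrite /= /isphere_cmap bitmap_comp //; apply/implyP => /andP[h1 _].
exact: isphere_bit_le h1.
Qed.

Definition interval_sphere : chfunctor := ChFunctor isphere_tr_id isphere_tr_comp.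

Definition imod_bit (t : T) : bool := (bstart b <= t) && ~~ ended (bend b) t.
Definition imod_obj t : vectType F := 'rV[F]_(imod_bit t).
Definition imod_tr (s t : T) (h : s <= t) : 'Hom(imod_obj s, imod_obj t) :=
  bitmap (imod_bit s) (imod_bit t).
Fact imod_tr_id (t : T) (h : t <= t) x : imod_tr h x = x.
Proof. exact: bitmap_id. Qed.
Fact imod_tr_comp (r s t : T) (hrs : r <= s) (hst : s <= t) (hrt : r <= t) x :
  imod_tr hrt x = imod_tr hst (imod_tr hrs x).
Proof.
rewrite /imod_tr bitmap_comp //; apply/implyP => /andP[/andP[h1 _] /andP[_ h2]].
rewrite /imod_bit (le_trans h1 hrs) /=.
by case: (bend b) h2 => //= e; apply: contra => /le_trans; apply.
Qed.
Definition interval_module : persmod := PersMod imod_tr_id imod_tr_comp.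
End IntervalSphere.

(** * Generators *)

Section Generators.
Variable X : chfunctor.

(* A finite ordered family of homogeneous elements [gelt i] with degree and
   entrance time. *)
Record generators := Generators {
  gsize : nat;
  gdeg : 'I_gsize -> nat;
  gent : 'I_gsize -> T;
  gelt : forall i, X (gent i) (gdeg i) }.

Variable G : generators.

(* The image of the i-th generator in X_n^t; by convention it is 0 if the
   generator is not of degree n or enters after t. *)
Definition gen_at (i : 'I_(gsize G)) (t : T) (n : nat) : X t n :=
  match @eqP _ (gdeg i) n, @idP (gent i <= t) with
  | ReflectT e, ReflectT h => ecast k (X t k) e (ftr X h (gdeg i) (gelt i))
  | _, _ => 0
  end.

Lemma gen_atE i t (h : gent i <= t) : gen_at i t (gdeg i) = ftr X h (gdeg i) (gelt i).
Proof.
have aux (P : Prop) (b : bool) (r : reflect P b) (Y : Type) (f : P -> Y) (z : Y) (x : P) :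
    (forall x', f x' = f x) -> (if r is ReflectT x' then f x' else z) = f x.
  by case: r => [x'|/(_ x)].
rewrite /gen_at; case: eqP => // e; rewrite (eq_axiomK e) /=.
by apply: (aux _ _ _ _ (fun h' => ftr X h' _ _)) => h'; rewrite (bool_irrelevance h' h).
Qed.

Lemma gen_at_ent i : gen_at i (gent i) (gdeg i) = gelt i.
Proof. by rewrite gen_atE ftr_id. Qed.

Definition generates : Prop := forall t n,
  <<[seq gen_at i t n | i <- enum 'I_(gsize G)] ++
    [seq diff (X t) n (gen_at i t n.+1) | i <- enum 'I_(gsize G)]>>%VS = fullv.

(* Membership in the value at t of rad X_n. *)
Definition in_rad (t : T) n (v : X t n) : Prop :=
  exists k (s : 'I_k -> T) (h : forall j, s j < t) (w : forall j, X (s j) n),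
    v = \sum_j ftr X (ltW (h j)) n (w j).

Lemma in_rad0 t n : @in_rad t n 0.
Proof.
exists 0%N, (fun=> t), (fun j : 'I_0 => False_ind _ (notF (ltn_ord j))), (fun=> 0).
by rewrite big_ord0.
Qed.

Lemma in_radP t n (a : F) (u v : X t n) : in_rad u -> in_rad v -> in_rad (a *: u + v).
Proof.
move=> [k [s [h [w ->]]]] [k' [s' [h' [w' ->]]]].
pose S j := match split j with inl i => s i | inr i => s' i end.
have H j : S j < t by rewrite /S; case: (split j).
pose W j : X (S j) n :=
  match split j as o return X (match o with inl i => s i | inr i => s' i end) n with
  | inl i => a *: w i | inr i => w' i end.
exists (k + k')%N, S, H, W; rewrite big_split_ord /= scaler_sumr.
congr (_ + _); apply: eq_bigr => i _.
- have := H (lshift k' i); rewrite /W /S => HH.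
  move: (H _) ; rewrite /S; rewrite (unsplitK (inl i)) => Hi.
  by rewrite linearZ /=; congr (_ *: ftr X _ _ _); apply: bool_irrelevance.
- move: (H _); rewrite /W /S (unsplitK (inr i)) => Hi.
  by congr (ftr X _ _ _); apply: bool_irrelevance.
Qed.

Definition rad (t : T) n : {vspace X t n} :=
  projT1 (cid (vspace_of_prop (in_rad0 t n) (@in_radP t n))).

Lemma radP t n v : v \in rad t n <-> in_rad v.
Proof. by rewrite /rad; case: cid. Qed.

(* [basis_of] includes freeness, so the generators with given degree and
   entrance time have pairwise distinct classes. *)
Definition quasi_minimal : Prop := forall t n,
  basis_of fullv [seq class (rad t n) (gen_at i t n)
                 | i <- enum 'I_(gsize G) & (gent i == t) && (gdeg i == n)].

(* The first clause makes all the terms with [gen_at] equal to 0 by convention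
   have zero coefficient, so that the second one reads
   delta(x_j) = \sum_i d^i_j x_i. *)
Definition boundary_matrix (d : 'M[F]_(gsize G)) : Prop := forall j,
  (forall i, d i j != 0 -> ((gdeg i).+1 == gdeg j) && (gent i <= gent j)) /\
  (forall n, diff (X (gent j)) n (gen_at j (gent j) n.+1) =
             \sum_i d i j *: gen_at i (gent j) n).

End Generators.

(** * The interval sphere decomposition algorithm *)

Section Algorithm.
Variables (m : nat) (deg : 'I_m -> nat) (ent : 'I_m -> T).
Implicit Types (A : {set 'I_m}) (d : 'M[F]_m) (L : seq bar) (i j k h : 'I_m).

(* The current matrix is represented by an m x m matrix d together with the set
   A of indices of the rows and columns that have not been deleted; the entries
   outside of A are irrelevant. *)
Definition row_nonzero A d i : bool := [exists h in A, d i h != 0].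

Definition argmin_row A d i j : bool :=
  [&& j \in A, d i j != 0 & [forall h in A, (d i h != 0) ==> (ent j <= ent h)]].

Definition argmax_col A d j i : bool :=
  [&& i \in A, d i j != 0 & [forall h in A, (d h j != 0) ==> (ent h <= ent i)]].

Definition split_mx i j d : 'M[F]_m :=
  \matrix_(k, h) (d k h - (d i j)^-1 * d k j * d i h).
Definition split_set i j A : {set 'I_m} := A :\ i :\ j.

(* Control points: the head of the main loop, the two tests inside PAIR (on
   column j, then on row i), and the end. *)
Inductive state :=
| Main of {set 'I_m} & 'M[F]_m & seq bar
| TestCol of {set 'I_m} & 'M[F]_m & seq bar & 'I_m & 'I_m
| TestRow of {set 'I_m} & 'M[F]_m & seq bar & 'I_m & 'I_m
| Done of seq bar.

Definition emit_and_split A d L i j : state :=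
  Main (split_set i j A) (split_mx i j d)
       (rcons L (Bar (deg i) (ent i) (Some (ent j)))).

Inductive step : state -> state -> Prop :=
| StepChoose A d L i j :
    i \in A -> row_nonzero A d i -> argmin_row A d i j ->
    step (Main A d L) (TestCol A d L i j)
| StepColYes A d L i j :
    argmax_col A d j i -> step (TestCol A d L i j) (emit_and_split A d L i j)
| StepColNo A d L i j i' :
    ~~ argmax_col A d j i -> argmax_col A d j i' ->
    step (TestCol A d L i j) (TestRow A d L i' j)
| StepRowYes A d L i j :
    argmin_row A d i j -> step (TestRow A d L i j) (emit_and_split A d L i j)
| StepRowNo A d L i j j' :
    ~~ argmin_row A d i j -> argmin_row A d i j' ->
    step (TestRow A d L i j) (TestCol A d L i j')
| StepEnd A d L s :
    (forall i, i \in A -> ~~ row_nonzero A d i) -> perm_eq s (enum A) ->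
    step (Main A d L) (Done (L ++ [seq Bar (deg i) (ent i) None | i <- s])).

Definition start d : state := Main [set: 'I_m] d [::].

Definition reachable : state -> state -> Prop := clos_refl_trans_1n state step.

(* Every execution from c is finite. *)
Definition terminates (c : state) : Prop := Acc (fun c2 c1 => step c1 c2) c.

(* An execution from c can only stop by returning a list. *)
Definition never_stuck (c : state) : Prop := forall c', reachable c c' ->
  (exists L, c' = Done L) \/ (exists c'', step c' c'').

Definition returns (c : state) L : Prop := reachable c (Done L).

End Algorithm.

(* The list consists of interval spheres, whose direct sum is isomorphic to X. *)
Definition sphere_decomposition (X : chfunctor) (L : seq bar) : Prop :=
  all (fun b => le_end (bstart b) (bend b)) L /\
  chfunctor_iso X (sum_functor [seq interval_sphere b | b <- L]).

Definition barcode_decomposition (X : chfunctor) (L : seq bar) : Prop := forall n,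
  persmod_iso (homology_functor X n)
    (sum_persmod [seq interval_module b
                 | b <- L & (bdeg b == n) && lt_end (bstart b) (bend b)]).

End Functors.

(* Main.v *)
(** A quasi-minimal set of generators restricts to a basis of every X_n^t, so a
    change of basis x_j' = sum_i P^i_j x_i is compatible with the transition
    morphisms as soon as P^i_j vanishes unless deg(i) = deg(j) and
    ent(i) <= ent(j). When PAIR returns (i, j), the index i enters last in column
    j and j enters first in row i; hence delta(x_j) may replace x_i, and
    multiples of x_j may be subtracted from the other x_h so as to clear row i.
    Because the square of the boundary matrix is 0, in the new basis x_i' and x_j
    span a direct summand I^deg(i)[ent(i), ent(j)) and SPLIT computes the boundary
    matrix of a complement. When the remaining matrix is 0, X has a basis in which
    the boundary matrix is a partial matching, that is, X is a direct sum of
    interval spheres. Homology is additive, and H_n of an interval sphere is an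
    interval module or 0. *)
Require Import Defs.
From HB Require Import structures.
From Stdlib Require Import Relation_Operators.
From mathcomp Require Import all_boot all_order all_algebra zify ring.
From mathcomp Require Import reals interval_inference.

Set Implicit Arguments.
Unset Strict Implicit.
Unset Printing Implicit Defensive.
Import Order.TTheory GRing.Theory Num.Theory.
Local Open Scope ring_scope.

(** * Spans and linear independence of families indexed by a sequence *)

Section Families.
Variables (F : fieldType) (V : vectType F) (I : eqType) (v : I -> V).

(** Distinct indices matter: a repeated index would receive the same coefficient several times, and
    this multiple can vanish in positive characteristic. *)
Lemma span_mapP (s : seq I) w : uniq s -> w \in <<[seq v i | i <- s]>>%VS ->
  exists c : I -> F, w = \sum_(i <- s) c i *: v i.
Proof.
elim: s w => [|x s IHs] w /=.
  by rewrite span_nil memv0 => _ /eqP->; exists (fun=> 0); rewrite big_nil.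
case/andP=> xs us; rewrite span_cons => /memv_addP[_ /vlineP[a ->] [u us' ->]].
have [c ->] := IHs _ us us'.
exists (fun i => if i == x then a else c i); rewrite big_cons eqxx; congr (_ + _).
apply: eq_big_seq => i is_; case: eqP => // ix; by rewrite -ix is_ in xs.
Qed.

Lemma free_mapP (s : seq I) : uniq s ->
  free [seq v i | i <- s] <->
  (forall c : I -> F, \sum_(i <- s) c i *: v i = 0 -> {in s, forall i, c i = 0}).
Proof.
move=> us; split.
  elim: s us => [|x s IHs] //= /andP[xs us].
  rewrite free_cons => /andP[vx fs] c; rewrite big_cons => /eqP.
  rewrite addr_eq0 => /eqP cx.
  have cx0 : c x = 0.
    apply: contraNeq vx => cx0; rewrite -(scalerK cx0 (v x)) cx rpredZ // rpredN.
    rewrite big_seq; apply: rpred_sum => i is_; apply/rpredZ/memv_span/map_f/is_.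
  move: cx => /esym/eqP; rewrite cx0 scale0r oppr_eq0 => /eqP e i.
  by rewrite inE => /predU1P[->//|]; apply: IHs.
elim: s us => [|x s IHs] /=; first by rewrite nil_free.
case/andP=> xs us h; rewrite free_cons; apply/andP; split; last first.
  apply: IHs => // c e i is_.
  have := h (fun j => if j == x then 0 else c j).
  rewrite big_cons eqxx scale0r add0r.
  have -> : \sum_(j <- s) (if j == x then 0 else c j) *: v j = 0.
    rewrite -[RHS]e; apply: eq_big_seq => j js; case: eqP => // jx.
    by rewrite -jx js in xs.
  move=> /(_ erefl i); rewrite inE is_ orbT => /(_ isT).
  by case: eqP => // jx; rewrite -jx is_ in xs.
apply/negP => /(span_mapP us)[c e].
have := h (fun j => if j == x then -1 else c j).
rewrite big_cons eqxx scaleN1r.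
have -> : \sum_(j <- s) (if j == x then -1 else c j) *: v j = v x.
  rewrite e; apply: eq_big_seq => j js; case: eqP => // jx; by rewrite -jx js in xs.
by rewrite addNr => /(_ erefl x); rewrite inE eqxx => /(_ isT)/eqP; rewrite oppr_eq0 oner_eq0.
Qed.

End Families.

(** * Quasi-minimal generators *)

Section GeneratorBasis.
Variables (R : realType) (F : fieldType) (X : chfunctor R F).
Local Notation T := {nonneg R}.
Hypothesis fX : filtered X.
Variable G : generators X.
Hypothesis qmin : quasi_minimal G.
Local Notation m := (gsize G).
Implicit Types (s t : T) (n : nat) (i j k : 'I_m).

Definition alive t n i := (gdeg i == n) && (gent i <= t).

Lemma gen_at_dead i t n : ~~ alive t n i -> gen_at i t n = 0.
Proof.
have aux (P : Prop) (b : bool) (r : reflect P b) (Y : Type) (f : P -> Y) (z : Y) :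
    ~ P -> (if r is ReflectT x then f x else z) = z by case: r.
rewrite /alive /gen_at; case: (@eqP _ (gdeg i) n) => // e h.
by apply: (aux _ _ _ _ (fun h' => ecast q (X t q) e (ftr X h' _ _))); apply/negP.
Qed.

Lemma gen_at_tr i s t (h : s <= t) n : gent i <= s ->
  ftr X h n (gen_at i s n) = gen_at i t n.
Proof.
move=> is_; have [<-|ne] := eqVneq (gdeg i) n; last first.
  by rewrite !gen_at_dead ?linear0 // /alive (negPf ne).
by rewrite !gen_atE ?(le_trans is_ h) // => h'; rewrite -ftr_comp.
Qed.

Definition gspan t n := <<[seq gen_at i t n | i <- enum 'I_m]>>%VS.

Lemma gspan_tr s t (h : s <= t) n w : w \in gspan s n -> ftr X h n w \in gspan t n.
Proof.
case/(span_mapP (enum_uniq _))=> c ->; rewrite linear_sum; apply: rpred_sum => i _.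
rewrite linearZ; apply: rpredZ; have [is_|is_] := boolP (gent i <= s).
  by rewrite /= gen_at_tr //; apply/memv_span/map_f/mem_enum.
by rewrite gen_at_dead ?linear0 ?mem0v // /alive (negPf is_) andbF.
Qed.

(* Modulo the radical, w is spanned by the generators entering at t. An element of
   the radical comes from earlier times, and each of these may be moved back to
   the last jump a <= s of X, which decreases the number of jumps before t. *)
Lemma gspan_full t n w : w \in gspan t n.
Proof.
have [[taus [_ tautr]] _] := fX.
(* Time 0 is added to the jumps, so that every time has a jump at or before it. *)
have [t0 t0_ge] : exists t0 : T, forall u : T, t0 <= u by exists 0%:nng => u; exact: (ge0 u).
pose cnt (u : T) := count (fun a => a < u) (t0 :: taus).
have [k] := ubnP (cnt t); elim: k t w => // k IHk t w; rewrite ltnS => ck.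
have [c wc] : exists c : 'I_m -> F, class (Defs.rad X t n) w =
    \sum_(i <- [seq i <- enum 'I_m | (gent i == t) && (gdeg i == n)])
      c i *: class (Defs.rad X t n) (gen_at i t n).
  apply: span_mapP; first by rewrite filter_uniq ?enum_uniq.
  by have /andP[/eqP-> _] := qmin t n; rewrite memvf.
rewrite -(subrK (\sum_(i <- [seq i <- enum 'I_m | (gent i == t) && (gdeg i == n)])
                   c i *: gen_at i t n) w).
apply: rpredD; last first.
  by apply: rpred_sum => i _; apply/rpredZ/memv_span/map_f/mem_enum.
set u := w - _; have : u \in Defs.rad X t n.
  apply/classP; rewrite wc linear_sum; apply: eq_bigr => i _.
  by rewrite linearZ.
move/radP=> [l [s [h [z ->]]]]; apply: rpred_sum => a _.
have [b [b0 bs bmax]] : exists b : T, [/\ b \in t0 :: taus, b <= s a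
    & forall x, x \in taus -> x <= s a -> x <= b].
  elim: taus {cnt tautr IHk ck} => [|x l' [b [bl bs bmax]]].
    by exists t0; rewrite mem_head; split=> //; exact: t0_ge.
  have [xs|xs] := boolP (x <= s a); last first.
    exists b; split=> // [|y]; first by move: bl; rewrite !inE => /orP[->|->]; rewrite ?orbT.
    by rewrite inE => /predU1P[->|]; [rewrite (negPf xs) | exact: bmax].
  have [bx|bx] := leP b x.
    exists x; split=> // [|y]; first by rewrite !inE eqxx orbT.
    by rewrite inE => /predU1P[->//|yl ys]; apply: le_trans (bmax _ yl ys) bx.
  exists b; split=> // [|y]; first by move: bl; rewrite !inE => /orP[->|->]; rewrite ?orbT.
  by rewrite inE => /predU1P[-> _|]; [exact: ltW | exact: bmax].
(* No jump lies in [(b, s a]], so [z a] is the image of [g n (z a)], which lives at time [b]. *)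
have [|g [_ gK]] := tautr _ _ bs.
  by apply/hasPn => x xt; apply/negP => /andP[bx xs]; have := bmax _ xt xs; rewrite leNgt bx.
rewrite -(gK n (z a)) -ftr_comp; first exact: le_trans bs (ltW (h a)).
move=> bt; apply: gspan_tr; apply: IHk; apply: leq_trans ck; rewrite /cnt.
have bt' : b < t by apply: le_lt_trans bs (h a).
(* The jump [b] is counted at [t] but not at [b], so the count drops strictly. *)
have eI : count (predI (fun x => x < b) (pred1 b)) (t0 :: taus) = 0%N.
  by rewrite (@eq_count _ _ pred0) ?count_pred0 // => x /=; case: ltgtP.
have := count_predUI (fun x => x < b) (pred1 b) (t0 :: taus).
rewrite eI addn0 => eU;
  apply: (@leq_trans (count (predU (fun x => x < b) (pred1 b)) (t0 :: taus))).
  by rewrite eU -[leqLHS]addn1 leq_add2l -has_count has_pred1.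
by apply: sub_count => x /orP[xb|/eqP->//]; exact: lt_trans xb bt'.
Qed.

Definition alives t n := [seq i <- enum 'I_m | alive t n i].

Lemma alives_uniq t n : uniq (alives t n).
Proof. by rewrite filter_uniq ?enum_uniq. Qed.

Lemma mem_alives t n i : (i \in alives t n) = alive t n i.
Proof. by rewrite mem_filter mem_enum andbT. Qed.

(** Among the generators with nonzero coefficient take one that enters last. Since transitions are
    injective, the relation already holds at its entrance time; modulo the radical only generators
    entering at that very time survive, and quasi-minimality makes them independent. *)
Lemma gen_at_free t n : free [seq gen_at i t n | i <- alives t n].
Proof.
apply/free_mapP => [|c]; first exact: alives_uniq.
move=> c0 i0 i0s; apply/eqP; apply: contraT => ci0.
have ai0 : alive t n i0 && (c i0 != 0) by rewrite -mem_alives i0s.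
case: (@arg_maxP _ _ _ i0 (fun i => alive t n i && (c i != 0)) (@gent _ _ _ G) ai0).
move=> i /andP[ai ci] imax.
have it : gent i <= t by case/andP: ai.
have [_ inj] := fX.
have {c0} c0 : \sum_(j <- alives t n) c j *: gen_at j (gent i) n = 0.
  apply: (inj _ _ it n); rewrite linear0 linear_sum -[RHS]c0 /=.
  apply: eq_big_seq => j; rewrite mem_alives => aj; rewrite linearZ /=.
  have [->|cj] := eqVneq (c j) 0; first by rewrite !scale0r.
  by rewrite gen_at_tr //; apply: imax; rewrite aj.
have /andP[_] := qmin (gent i) n.
move/(free_mapP _ (filter_uniq _ (enum_uniq _))) => /(_ c) ci'.
case/negP: ci; apply/eqP; apply: ci'; last first.
  by rewrite mem_filter eqxx mem_enum; case/andP: ai => ->.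
move/(congr1 (class (Defs.rad X (gent i) n))): c0; rewrite linear0 linear_sum => c0.
rewrite -[RHS]c0 !big_filter big_mkcond [RHS]big_mkcond; apply: eq_bigr => j _.
rewrite /alive; have [dj|] := eqVneq (gdeg j) n; last by rewrite andbF.
rewrite andbT linearZ /=; case: (ltgtP (gent j) (gent i)) => [ji|ij|->].
- rewrite (le_trans (ltW ji) it) (_ : class _ _ = 0) ?scaler0 //.
  rewrite -(linear0 (class (Defs.rad X (gent i) n))); apply/classP; rewrite subr0.
  apply/radP; exists 1%N, (fun=> gent j), (fun=> ji), (fun=> gen_at j (gent j) n).
  by rewrite big_ord1 gen_at_tr.
- by rewrite gen_at_dead ?linear0 ?scaler0 ?if_same // /alive leNgt ij andbF.
- by rewrite it.
Qed.

Lemma gen_at_basis t n : basis_of fullv [seq gen_at i t n | i <- alives t n].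
Proof.
rewrite basisEfree gen_at_free subvf /= -(eqP (gen_at_free t n)) dimvS //.
apply/subvP => w _; have := gspan_full w; apply: subvP; apply/span_subvP => _ /mapP[i _ ->].
have [ai|ai] := boolP (alive t n i); last by rewrite gen_at_dead ?mem0v.
by apply/memv_span/map_f; rewrite mem_alives.
Qed.

Lemma big_alives t n (c : 'I_m -> F) :
  \sum_i c i *: gen_at i t n = \sum_(i <- alives t n) c i *: gen_at i t n.
Proof.
rewrite big_filter big_enum_cond [RHS]big_mkcond; apply: eq_bigr => i _ /=.
by case: ifPn => // /gen_at_dead->; rewrite scaler0.
Qed.

Lemma gen_at_indep t n (c : 'I_m -> F) :
  \sum_i c i *: gen_at i t n = 0 -> forall i, alive t n i -> c i = 0.
Proof.
rewrite big_alives => c0 i; rewrite -mem_alives; move: i.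
exact: (free_mapP _ (alives_uniq t n)).1 (gen_at_free t n) c c0.
Qed.

(** Column [j] consists of the coordinates of the boundary of the [j]-th generator in the basis at
    its entrance time. Entries that this expansion leaves open are forced to be 0 by the condition
    on degrees and entrance times, whence uniqueness. *)
Lemma boundary_matrix_exists : exists! d, boundary_matrix (G := G) d.
Proof.
have [j|f fP] := fin_all_exists (T := 'I_m) (U := fun=> 'I_m -> F) (P := fun j c =>
   (forall i, c i != 0 -> ((gdeg i).+1 == gdeg j) && (gent i <= gent j)) /\
   (forall n, diff (X (gent j)) n (gen_at j (gent j) n.+1) =
             \sum_i c i *: gen_at i (gent j) n)).
  (* A generator of degree 0 has no boundary, so its column is zero. *)
  have [dj|dj] := posnP (gdeg j).
    exists (fun=> 0); split=> [i|n]; first by rewrite eqxx.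
    rewrite gen_at_dead ?linear0 /alive ?dj // big1 // => i _; exact: scale0r.
  pose n := (gdeg j).-1; have nE : n.+1 = gdeg j by rewrite prednK.
  have := memvf (diff (X (gent j)) n (gen_at j (gent j) n.+1)).
  have /andP[/eqP<- _] := gen_at_basis (gent j) n.
  case/(span_mapP (alives_uniq _ _)) => c cE.
  (* [span_mapP] says nothing about coefficients off [alives]; they are set to 0 to meet the support
     condition. *)
  exists (fun i => if alive (gent j) n i then c i else 0); split=> [i|n'].
    by case: ifPn => [|_]; [rewrite -nE eqSS | rewrite eqxx].
  have [->|nn] := eqVneq n' n.
    rewrite cE big_alives; apply: eq_big_seq => i; by rewrite mem_alives => ->.
  rewrite gen_at_dead ?linear0 /alive; last by rewrite -nE eqSS eq_sym (negPf nn).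
  rewrite big1 // => i _; case: eqP => [e|]; last by rewrite scale0r.
  by rewrite gen_at_dead ?scaler0 // /alive e eq_sym (negPf nn).
exists (\matrix_(i, j) f j i); split=> [j|d dP].
  have [h1 h2] := fP j; split=> [i|n]; first by rewrite mxE; apply: h1.
  by rewrite h2; apply: eq_bigr => i _; rewrite mxE.
apply/matrixP => i j; rewrite mxE.
have [h1 h2] := fP j; have [g1 g2] := dP j.
have [/andP[/eqP dij eij]|no] := boolP (((gdeg i).+1 == gdeg j) && (gent i <= gent j)).
  apply/eqP; rewrite -subr_eq0; apply/eqP.
  apply: (@gen_at_indep (gent j) (gdeg i) (fun i => f j i - d i j));
    last by rewrite /alive eqxx.
  under eq_bigr do rewrite scalerBl.
  by rewrite sumrB -h2 -g2 subrr.
have [->|/h1] := eqVneq (f j i) 0; last by rewrite (negPf no).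
by have [->|/g1] := eqVneq (d i j) 0; last by rewrite (negPf no).
Qed.

Section BoundaryMatrix.
Variable D : 'M[F]_m.
Hypothesis DP : boundary_matrix (G := G) D.

Lemma diff_gen_at j t n : gent j <= t ->
  diff (X t) n (gen_at j t n.+1) = \sum_i D i j *: gen_at i t n.
Proof.
move=> jt; have [h1 h2] := DP j.
rewrite -(gen_at_tr jt) // -cmapE h2 linear_sum; apply: eq_bigr => i _; rewrite linearZ /=.
have [->|/h1/andP[_ ij]] := eqVneq (D i j) 0; first by rewrite !scale0r.
by rewrite gen_at_tr.
Qed.

(** The [j]-th column holds the coefficients of the double boundary of the [j]-th generator. A
    nonzero product of entries shows that generator [h] is present at [gent j], so independence
    applies to its coefficient. *)
Lemma boundary_matrix_sqr : D *m D = 0.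
Proof.
apply/matrixP => h j; rewrite [RHS]mxE; apply/eqP; apply: contraT => nz.
have /existsP[i /andP[Dhi Dij]] : [exists i, (D h i != 0) && (D i j != 0)].
  apply: contraNT nz => /existsPn no; rewrite mxE big1 // => i _; apply/eqP.
  by rewrite mulf_eq0; have := no i; rewrite negb_and !negbK.
have /andP[/eqP e1 l1] := (DP i).1 h Dhi; have /andP[/eqP e2 l2] := (DP j).1 i Dij.
rewrite (_ : (D *m D) h j = 0) ?eqxx // in nz.
apply: (@gen_at_indep (gent j) (gdeg h) (fun h => (D *m D) h j)).
  have /lfunP/(_ (gen_at j (gent j) (gdeg h).+2)) := diff2 (X (gent j)) (gdeg h).
  rewrite comp_lfunE zero_lfunE diff_gen_at // linear_sum => e; rewrite -[RHS]e.
  under eq_bigr do rewrite mxE scaler_suml.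
  rewrite exchange_big; apply: eq_bigr => k _; rewrite linearZ /=.
  have [->|/(DP j).1/andP[_ kj]] := eqVneq (D k j) 0.
    by rewrite scale0r big1 // => l _; rewrite mulr0 scale0r.
  by rewrite diff_gen_at // scaler_sumr; apply: eq_bigr => l _; rewrite scalerA mulrC.
by rewrite /alive eqxx (le_trans l1 l2).
Qed.

End BoundaryMatrix.

End GeneratorBasis.

(** * The algorithm *)

Section SplitMatrix.
Variables (F : fieldType) (m : nat) (N : 'M[F]_m) (i j : 'I_m).
Hypotheses (NN : N *m N = 0) (ij : i != j) (Nij : N i j != 0).

(* The i-th new basis vector is the boundary of the j-th old one, and the j-th
   basis vector is subtracted from the others so as to clear the i-th row of N. *)
Definition split_basis : 'M[F]_m := \matrix_(k, h)
  if h == i then N k j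
  else (k == h)%:R - ((k == j) && (h != j))%:R * (N i h / N i j).

(** The differential in the new basis. [split_mx] already vanishes on row [i] and column [j], where
    only the entry 1 of the new pair is inserted; row [j] and column [i] are zero because the square
    of [N] is. *)
Definition split_bnd : 'M[F]_m := \matrix_(k, h)
  if (k == i) && (h == j) then 1
  else if (k == j) || (h == i) then 0 else split_mx i j N k h.

(** If [v] is a row vector with [v *m split_basis = 0], then column [j] gives [v_j = 0], the columns
    other than [i] and [j] give the other coordinates, and column [i] leaves [v_i * N i j = 0]. *)
Lemma split_basis_unit : split_basis \in unitmx.
Proof.
rewrite -row_free_unit; apply: inj_row_free => v v0.
have vE h : \sum_k v 0 k * split_basis k h = 0.
  by move/rowP/(_ h): v0; rewrite !mxE.
have vh h : h != i -> v 0 h = 0.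
  have vj : v 0 j = 0.
    rewrite -[RHS](vE j) (bigD1 j) //= mxE eqxx /= eq_sym (negPf ij) /= mul0r subr0 mulr1.
    rewrite big1 ?addr0 // => k kj.
    by rewrite mxE eq_sym (negPf ij) (negPf kj) mul0r subr0 mulr0.
  move=> hi; have [->//|hj] := eqVneq h j.
  rewrite -[RHS](vE h) (bigD1 h) //= mxE eqxx (negPf hi) (negPf hj) /= mul0r subr0 mulr1.
  rewrite big1 ?addr0 // => k kh.
  rewrite mxE (negPf hi) (negPf kh); have [->|kj] := eqVneq k j; first by rewrite vj mul0r.
  by rewrite /= mul0r subr0 mulr0.
apply/rowP => h; rewrite [RHS]mxE; have [->|/vh//] := eqVneq h i.
have := vE i; rewrite (bigD1 i) //= mxE eqxx big1 => [/eqP|k /vh->]; last by rewrite mul0r.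
by rewrite addr0 mulf_eq0 (negPf Nij) orbF => /eqP.
Qed.

(** Compared column by column. Column [i] is zero on both sides since [N *m N = 0], and column [j]
    holds by the choice of the new [i]-th vector. In any other column [N] produces [split_mx], whose
    row [j], dropped in [split_bnd], must be recovered. *)
Lemma split_basisP : N *m split_basis = split_basis *m split_bnd.
Proof.
have NNe a b : \sum_k N a k * N k b = 0 by move/matrixP/(_ a b): NN; rewrite !mxE.
have ji : (j == i) = false by rewrite eq_sym (negPf ij).
apply/matrixP => a b; rewrite !mxE.
have [-> {b}|bi] := eqVneq b i.
  rewrite [RHS]big1; first by rewrite -[RHS](NNe a j); apply: eq_bigr => k _; rewrite mxE eqxx.
  by move=> k _; rewrite [split_bnd _ _]mxE eqxx orbT eq_sym (negPf ij) andbF mulr0.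
have [-> {b bi}|bj] := eqVneq b j.
  rewrite (bigD1 j) //= [RHS](bigD1 i) //= !mxE !eqxx ji /= mul0r subr0 !mulr1.
  rewrite !big1 // => k kn; rewrite !mxE.
    rewrite eqxx andbT (negPf kn) ji.
    by case: ifP => _; rewrite ?mulr0 // [_ * _ * _]mulrAC mulVf // mul1r subrr mulr0.
  by rewrite eqxx ji (negPf kn) mul0r subr0 mulr0.
have -> : \sum_k N a k * split_basis k b = split_mx i j N a b.
  rewrite (bigD1 b) //= mxE (negPf bi) eqxx (negPf bj) /= mul0r subr0 mulr1.
  rewrite (bigD1 j) 1?eq_sym //= mxE (negPf bi) [j == b]eq_sym (negPf bj) eqxx mul1r sub0r.
  rewrite big1 ?addr0 => [|k /andP[kb kj]]; first by rewrite mxE; ring.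
  by rewrite mxE (negPf bi) (negPf kb) (negPf kj) mul0r subr0 mulr0.
pose S := split_mx i j N.
(* Row [i] of [N] annihilates the columns of [S]; solving for the term [k = j] expresses [S j b]
   through the rows kept in [split_bnd]. *)
have NS : \sum_k N i k * S k b = 0.
  under eq_bigr => k _ do rewrite mxE mulrBr.
  rewrite sumrB NNe sub0r; apply/eqP; rewrite oppr_eq0; apply/eqP.
  transitivity ((\sum_k N i k * N k j) * ((N i j)^-1 * N i b)); last by rewrite NNe mul0r.
  by rewrite mulr_suml; apply: eq_bigr => k _; ring.
(* Hence column [i] of [split_basis], the only one not close to the identity, contributes
   nothing. *)
have Sib : S i b = 0 by rewrite mxE mulVf // mul1r subrr.
transitivity (\sum_k split_basis a k * ((k != j)%:R * S k b)); last first.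
  apply: eq_bigr => k _; congr (_ * _); rewrite [RHS]mxE (negPf bj) (negPf bi) andbF orbF.
  by case: (k == j); rewrite ?mul0r ?mul1r.
rewrite -/S; have [-> {a}|aj] := eqVneq a j.
  transitivity (- (N i j)^-1 * \sum_(k | k != j) N i k * S k b).
    move: NS; rewrite (bigD1 j) //= => /eqP; rewrite addr_eq0 => /eqP e;
      rewrite mulNr -mulrN -e mulKf //.
  rewrite [RHS](bigD1 j) //= eqxx mul0r mulr0 add0r mulr_sumr; apply: eq_bigr => k kj.
  rewrite kj mul1r [split_basis _ _]mxE eqxx kj [j == k]eq_sym (negPf kj);
    have [->|_] := eqVneq k i.
    by rewrite Sib !mulr0.
  by rewrite mul1r sub0r; ring.
rewrite (bigD1 a) //= aj mul1r big1 ?addr0 => [|k ka].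
  rewrite [split_basis _ _]mxE eqxx (negPf aj) mul0r subr0; have [->|_] := eqVneq a i;
    last by rewrite mul1r.
  by rewrite Sib mulr0.
rewrite [split_basis _ _]mxE [a == k]eq_sym (negPf ka) (negPf aj) mul0r subr0.
by have [->|_] := eqVneq k i; rewrite ?Sib ?mulr0 ?mul0r.
Qed.

End SplitMatrix.

(** * Invariant, progress and termination of the runs *)

Section Run.
Variables (R : realType) (F : fieldType) (m : nat).
Variables (deg : 'I_m -> nat) (ent : 'I_m -> {nonneg R}).
Implicit Types (A : {set 'I_m}) (d P N D : 'M[F]_m) (L : seq (bar R)).

Definition filtered_mx P := forall i j, P i j != 0 -> deg i = deg j /\ ent i <= ent j.
Definition boundary_mx N := forall i j, N i j != 0 -> (deg i).+1 = deg j /\ ent i <= ent j.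

Lemma filtered_mxM P Q : filtered_mx P -> filtered_mx Q -> filtered_mx (P *m Q).
Proof.
move=> fP fQ i j PQ; have /existsP[k /andP[/fP[-> h1] /fQ[-> h2]]] :
    [exists k, (P i k != 0) && (Q k j != 0)].
  apply: contraNT PQ => /existsPn no; rewrite mxE big1 // => k _; apply/eqP.
  by rewrite mulf_eq0; have := no k; rewrite negb_and !negbK.
by split=> //; apply: le_trans h1 h2.
Qed.

Variable D : 'M[F]_m.
Hypotheses (DD : D *m D = 0) (bD : boundary_mx D).

(* [P] is a filtered change of basis which conjugates the total boundary matrix
   [D] to [N]; [N] is the current matrix on [A] and the pairing [ps] off [A]. *)
Record partial A d L P N (ps : seq ('I_m * 'I_m)) : Prop := Partial {
  partial_unit : P \in unitmx;
  partial_filt : filtered_mx P;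
  partial_conj : D *m P = P *m N;
  partial_bnd : boundary_mx N;
  partial_in : {in A &, forall k h, N k h = d k h};
  partial_out : forall k h, ~~ ((k \in A) && (h \in A)) -> N k h = ((k, h) \in ps)%:R;
  partial_perm : perm_eq (unzip1 ps ++ unzip2 ps ++ enum A) (enum 'I_m);
  partial_list : L = [seq Bar (deg q.1) (ent q.1) (Some (ent q.2)) | q <- ps] }.

Lemma partial_start : partial setT D [::] 1%:M D [::].
Proof.
split=> //; first exact: unitmx1.
- by move=> i j; rewrite mxE; have [->|_] := eqVneq i j; rewrite ?eqxx.
- by rewrite mulmx1 mul1mx.
- by move=> k h; rewrite !inE.
- by rewrite /= enum_setT enumT.
Qed.

(** By [partial_perm] the paired indices and [A] partition all indices. *)
Lemma partial_disjoint A d L P N ps k h : partial A d L P N ps ->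
  (k \in A) || (h \in A) -> (k, h) \notin ps.
Proof.
move=> pp; have := perm_uniq (partial_perm pp); rewrite enum_uniq !cat_uniq.
case/and5P=> _ /hasPn no1 _ /hasPn no2 _ kh; apply/negP => khps.
case/orP: kh => [kA|hA].
  have := no1 k; rewrite mem_cat mem_enum kA orbT => /(_ isT)/negP; apply.
  by apply/mapP; exists (k, h).
have := no2 h; rewrite mem_enum hA => /(_ isT)/negP; apply.
by apply/mapP; exists (k, h).
Qed.

Lemma partial_sqr A d L P N ps : partial A d L P N ps -> N *m N = 0.
Proof.
move=> pp; have PN := partial_conj pp; apply: (can_inj (mulKmx (partial_unit pp))).
by rewrite mulmx0 mulmxA -PN -mulmxA -PN mulmxA DD mul0mx.
Qed.

(** The two extremality tests give the entrance-time bounds for the base change and for the new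
    matrix. *)
Lemma partial_split A d L P N ps i j : partial A d L P N ps ->
    argmin_row ent A d i j -> argmax_col ent A d j i ->
  partial (split_set i j A) (split_mx i j d)
    (rcons L (Bar (deg i) (ent i) (Some (ent j))))
    (P *m split_basis N i j) (split_bnd N i j) (rcons ps (i, j)).
Proof.
move=> pp /and3P[jA dij /forall_inP jmin] /and3P[iA _ /forall_inP imax].
have Nd := partial_in pp; have Nij : N i j != 0 by rewrite Nd.
have [dgij leij] := partial_bnd pp Nij.
have ij : i != j by apply: contra_eq_neq dgij => ->;
  rewrite -[X in _ != X]addn0 -addn1 eqn_add2l.
(* No nonzero entry of [N] links [A] to its complement, so row [i] and column [j] of [N] are
   supported on [A], where the tests control them. *)
have NA k h : (k \in A) || (h \in A) -> N k h != 0 -> (k \in A) && (h \in A).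
  move=> kh; apply: contra_neqT => /(partial_out pp)->.
  by rewrite (negPf (partial_disjoint pp kh)).
have Nj k : N k j != 0 -> [/\ k \in A, deg k = deg i & ent k <= ent i].
  move=> Nk; have /andP[kA _] : (k \in A) && (j \in A) by rewrite NA // jA orbT.
  split=> //; first by case: (partial_bnd pp Nk) => h _; apply: succn_inj; rewrite h.
  by apply: (implyP (imax k kA)); rewrite -Nd.
have Ni h : N i h != 0 -> [/\ h \in A, deg j = deg h & ent j <= ent h].
  move=> Nh; have /andP[_ hA] : (i \in A) && (h \in A) by rewrite NA // iA.
  split=> //; first by case: (partial_bnd pp Nh) => <- _.
  by apply: (implyP (jmin h hA)); rewrite -Nd.
split.
- by rewrite unitmx_mul (partial_unit pp) split_basis_unit.
(* Column [i] of [split_basis] is column [j] of [N], bounded by [Nj]; its off-diagonal entries in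
   row [j] come from row [i] of [N], bounded by [Ni]. *)
- apply: filtered_mxM (partial_filt pp) _ => k h; rewrite mxE.
  have [->|hi] := eqVneq h i; first by case/Nj.
  have [->|kh] := eqVneq k h; first by [].
  have [->|_] := eqVneq k j; last by rewrite mul0r subr0 eqxx.
  by rewrite sub0r oppr_eq0 !mulf_eq0 !negb_or => /and3P[_ /Ni[]].
- by rewrite mulmxA (partial_conj pp) -!mulmxA (split_basisP (partial_sqr pp)).
- move=> k h; rewrite mxE; case: ifP => [/andP[/eqP-> /eqP->] //|_].
  case: ifP => _; first by rewrite eqxx.
  rewrite mxE; have [Nkh|/(partial_bnd pp)//] := eqVneq (N k h) 0.
  (* A new entry [(k, h)] needs [N k j] and [N i h] nonzero, so
     [ent k <= ent i <= ent j <= ent h]. *)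
  rewrite Nkh sub0r oppr_eq0 !mulf_eq0 !negb_or => /andP[/andP[_ /Nj[_ -> ki]] /Ni[_ <- jh]].
  by split=> //; apply: le_trans ki (le_trans leij jh).
- move=> k h; rewrite !inE => /and3P[kj ki kA] /and3P[hj hi hA]; rewrite mxE.
  by rewrite (negPf ki) (negPf kj) (negPf hi) /= !mxE !Nd.
- move=> k h; rewrite !inE negb_and mem_rcons inE xpair_eqE mxE.
  have [->|ki] := eqVneq k i.
    rewrite iA ?andbF /= => _; have [->//|hj] := eqVneq h j.
    rewrite (negPf (partial_disjoint pp _)) ?iA // mxE (negPf ij) /= mulVf // mul1r subrr.
    by rewrite if_same.
  have [->|hj] := eqVneq h j.
    rewrite ?andbF /= => _; rewrite (negPf (partial_disjoint pp _)) ?jA ?orbT //.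
    by rewrite mxE mulrAC mulVf // mul1r subrr if_same.
  have [->|kj] := eqVneq k j.
    by rewrite (negPf (partial_disjoint pp _)) ?jA.
  have [->|hi] := eqVneq h i.
    by rewrite (negPf (partial_disjoint pp _)) ?iA ?orbT.
  rewrite /= -negb_and => nA; rewrite mxE (partial_out pp nA).
  (* The correction term lives on [A] in both indices, so earlier pairs are left intact. *)
  suff e0 : N k j * N i h = 0 by rewrite -mulrA e0 mulr0 subr0.
  apply/eqP; apply: contraNT nA; rewrite mulf_eq0 negb_or.
  by case/andP=> /Nj[-> _ _] /Ni[-> _ _].
- have pA : perm_eq (enum A) [:: i, j & enum (split_set i j A)].
    apply: uniq_perm;
      rewrite ?enum_uniq //= ?inE ?mem_enum ?inE ?eqxx ?enum_uniq ?negb_or ?ij ?andbF //.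
    move=> k; rewrite !inE !mem_enum !inE.
    have [->|_] := eqVneq k i; first by rewrite iA.
    by have [->|_] := eqVneq k j; rewrite ?jA.
  apply: perm_trans (partial_perm pp); rewrite /unzip1 /unzip2 !map_rcons.
  move/permP: pA => pA; apply/permP => a; rewrite -!cats1 !count_cat pA /=; lia.
- by rewrite map_rcons (partial_list pp).
Qed.

Definition bar_of (q : 'I_m * option 'I_m) : bar R :=
  Bar (deg q.1) (ent q.1) (omap ent q.2).

Definition indices (q : 'I_m * option 'I_m) : seq 'I_m :=
  if q.2 is Some j then [:: q.1; j] else [:: q.1].

(** State at the end of a run: [N] is the matrix of a partial matching, [(i, Some j)] being a
    matched pair and [(i, None)] an unmatched index. *)
Record complete L P N (qs : seq ('I_m * option 'I_m)) : Prop := Complete {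
  complete_unit : P \in unitmx;
  complete_filt : filtered_mx P;
  complete_conj : D *m P = P *m N;
  complete_bnd : boundary_mx N;
  complete_pair : forall k h, N k h = ((k, Some h) \in qs)%:R;
  complete_perm : perm_eq (flatten [seq indices q | q <- qs]) (enum 'I_m);
  complete_list : L = [seq bar_of q | q <- qs] }.

Lemma partial_complete A d L P N ps (s : seq 'I_m) : partial A d L P N ps ->
    (forall i, i \in A -> ~~ row_nonzero A d i) -> perm_eq s (enum A) ->
  complete (L ++ [seq Bar (deg i) (ent i) None | i <- s]) P N
    ([seq (q.1, Some q.2) | q <- ps] ++ [seq (i, None) | i <- s]).
Proof.
move=> pp dA sA; split; try by case: pp.
- move=> k h; rewrite mem_cat orbC.
  have /negPf-> /= : (k, Some h) \notin [seq (i, @None 'I_m) | i <- s].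
    by apply/mapP => -[].
  rewrite (mem_map (f := fun q : 'I_m * 'I_m => (q.1, Some q.2)) _ _ (k, h)); last first.
    by move=> [a b] [a' b'] [-> ->].
  have [/andP[kA hA]|] := boolP ((k \in A) && (h \in A)); last exact: partial_out pp _ _.
  rewrite (negPf (partial_disjoint pp _)) ?kA // (partial_in pp) //.
  by apply/eqP; have /exists_inPn/(_ h hA) := dA k kA; rewrite negbK.
- apply: perm_trans (partial_perm pp); rewrite map_cat flatten_cat catA.
  rewrite -map_comp; apply: perm_cat; last first.
    by rewrite -map_comp (eq_map (g := fun i => [:: i])) // flatten_seq1.
  rewrite /unzip1 /unzip2; elim: ps {pp} => //= q ps IHps.
  by move/permP: IHps => IHps; apply/permP => a; rewrite /= IHps !count_cat /=; lia.
- by rewrite (partial_list pp) map_cat -!map_comp.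
Qed.

(** Inside PAIR one extremality condition is always already known, namely the one not about to be
    tested. It makes a successful test sufficient for [partial_split], and its nonzero entry [d i j]
    guarantees a replacement when the test fails. *)
Definition run_invariant (c : state R F m) : Prop :=
  match c with
  | Main A d L => exists P N ps, partial A d L P N ps
  | TestCol A d L i j =>
      [/\ exists P N ps, partial A d L P N ps, i \in A & argmin_row ent A d i j]
  | TestRow A d L i j =>
      [/\ exists P N ps, partial A d L P N ps, j \in A & argmax_col ent A d j i]
  | Done L => exists P N qs, complete L P N qs
  end.

Lemma run_invariant_step c c' : run_invariant c -> step deg ent c c' -> run_invariant c'.
Proof.
move=> ic st;
  case: st ic => {c c'} [A d L i j iA _ ij|A d L i j ji|A d L i j i' _ ji|A d L i j ij
  |A d L i j j' _ ij|A d L s dA sA] /=.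
- by move=> pp.
- by case=> -[P [N [ps pp]]] _ ij; do 3!eexists; exact: partial_split pp ij ji.
- by case=> pp _ /and3P[jA _ _].
- by case=> -[P [N [ps pp]]] _ ji; do 3!eexists; exact: partial_split pp ij ji.
- by case=> pp _ /and3P[iA _ _].
- by case=> [P [N [ps pp]]]; do 3!eexists; exact: partial_complete pp dA sA.
Qed.

Lemma run_invariant_reachable c c' : reachable deg ent c c' -> run_invariant c -> run_invariant c'.
Proof. by elim=> // {}c c1 c2 /run_invariant_step st _ IH /st/IH. Qed.

Lemma argmin_row_exists A d i : row_nonzero A d i -> exists j, argmin_row ent A d i j.
Proof.
case/exists_inP=> h hA dih; have hP : (h \in A) && (d i h != 0) by rewrite hA.
case: (@arg_minP _ _ _ h (fun h => (h \in A) && (d i h != 0)) ent hP) => j /andP[jA dij] jmin; exists j.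
rewrite /argmin_row jA dij; apply/forall_inP => k kA; apply/implyP => dik.
by apply: jmin; rewrite kA.
Qed.

Lemma argmax_col_exists A d i j : i \in A -> d i j != 0 -> exists k, argmax_col ent A d j k.
Proof.
move=> iA dij; have hP : (i \in A) && (d i j != 0) by rewrite iA.
case: (@arg_maxP _ _ _ i (fun h => (h \in A) && (d h j != 0)) ent hP) => k /andP[kA dkj] kmax; exists k.
rewrite /argmax_col kA dkj; apply/forall_inP => h hA; apply/implyP => dhj.
by apply: kmax; rewrite hA.
Qed.

Lemma run_invariant_progress c : run_invariant c ->
  (exists L, c = Done F m L) \/ (exists c', step deg ent c c').
Proof.
case: c => [A d L _|A d L i j [_ iA /and3P[_ dij _]]|A d L i j [_ jA /and3P[iA dij _]]|L _];
  [right..|by left; exists L].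
- have [/exists_inP[i iA ri]|/exists_inPn dA] := boolP [exists i in A, row_nonzero A d i].
    by have [j ij] := argmin_row_exists ri; eexists; exact: StepChoose iA ri ij.
  by eexists; apply: StepEnd dA (perm_refl _).
- have [ji|ji] := boolP (argmax_col ent A d j i); first by eexists; exact: StepColYes.
  by have [i' ji'] := argmax_col_exists iA dij; eexists; exact: StepColNo ji ji'.
- have [ij|ij] := boolP (argmin_row ent A d i j); first by eexists; exact: StepRowYes.
  have /argmin_row_exists[j' ij'] : row_nonzero A d i by apply/exists_inP; exists j.
  by eexists; exact: StepRowNo ij ij'.
Qed.

(** Entrance times are real numbers; their rank turns strict comparison into a measure in natural
    numbers. *)
Definition ent_rank i : nat := #|[set h | ent h < ent i]|.

Lemma ent_rank_lt i k : ent i < ent k -> (ent_rank i < ent_rank k)%N.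
Proof.
move=> ik; apply: proper_card; apply/properP; split.
  by apply/subsetP => h; rewrite !inE => /lt_trans; apply.
by exists i; rewrite !inE ?ltxx.
Qed.

Lemma ent_rank_le i : (ent_rank i <= m)%N.
Proof. by rewrite -[leqRHS]card_ord max_card. Qed.

(* During a run of PAIR the entrance time of i increases and that of j
   decreases; each run of SPLIT removes two indices. *)
Definition weight (c : state R F m) : nat :=
  match c with
  | Main A _ _ => #|A| * (2 * m + 2) + (2 * m + 1)
  | TestCol A _ _ i j | TestRow A _ _ i j => #|A| * (2 * m + 2) + (m - ent_rank i + ent_rank j)
  | Done _ => 0
  end.

Lemma card_split_set A i j : (i \in A) || (j \in A) -> (#|split_set i j A| < #|A|)%N.
Proof.
move=> ij; apply: proper_card; apply/properP; split.
  by apply/subsetP => k; rewrite !inE => /and3P[].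
by case/orP: ij => kA; [exists i | exists j]; rewrite // !inE eqxx ?andbF.
Qed.

Lemma weight_step c c' : run_invariant c -> step deg ent c c' -> (weight c' < weight c)%N.
Proof.
(* Ranks are at most [m], so the second summand of [weight] is at most [2 * m] inside PAIR and
   [2 * m + 1] at the loop head; losing one index costs [2 * m + 2], more than this reset. *)
have aux a a' x : (a' < a)%N -> (a' * (2 * m + 2) + (2 * m + 1) < a * (2 * m + 2) + x)%N.
  by move=> a'a; have : (a'.+1 * (2 * m + 2) <= a * (2 * m + 2))%N;
    [rewrite leq_mul2r a'a orbT | lia].
move=> ic st;
  case: st ic => {c c'} [A d L i j iA _ ij|A d L i j ji|A d L i j i' ji ji'|A d L i j ij
  |A d L i j j' ij ij'|A d L s dA sA] /=.
- have := ent_rank_le i; have := ent_rank_le j; lia.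
- case/and3P: ji => iA _ _ _; have : (#|split_set i j A| < #|A|)%N.
    by rewrite card_split_set ?iA.
  exact: aux.
- case=> _ iA /and3P[_ dij _]; case/and3P: ji' => _ _ /forall_inP imax.
  have : ent i < ent i'.
    rewrite ltNge; apply: contra ji => ii'; rewrite /argmax_col iA dij.
    apply/forall_inP => h hA; apply/implyP => dhj; apply: le_trans ii'.
    exact: (implyP (imax h hA)).
  (* The bounds on ranks rule out truncation in [m - ent_rank i]. *)
  move/ent_rank_lt; have := ent_rank_le i; have := ent_rank_le i'; lia.
- case/and3P: ij => jA _ _ _; have : (#|split_set i j A| < #|A|)%N.
    by rewrite card_split_set ?jA ?orbT.
  exact: aux.
- case=> _ jA /and3P[_ dij _]; case/and3P: ij' => _ _ /forall_inP jmin.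
  have : ent j' < ent j.
    rewrite ltNge; apply: contra ij => jj'; rewrite /argmin_row jA dij.
    apply/forall_inP => h hA; apply/implyP => dih; apply: le_trans jj' _.
    exact: (implyP (jmin h hA)).
  move/ent_rank_lt; lia.
- lia.
Qed.

Lemma run_invariant_terminates c : run_invariant c -> terminates deg ent c.
Proof.
have [k] := ubnP (weight c); elim: k c => [c|k IHk c]; first by rewrite ltn0.
rewrite ltnS => ck ic.
split=> c' st; apply: IHk (run_invariant_step ic st).
by move: (weight c') (weight c) (weight_step ic st) ck => a b; apply: leq_trans.
Qed.

End Run.

(** * Sums of interval spheres *)

Section LinearMaps.
Variable F : fieldType.

Definition lfun_copair (U V W : vectType F) (f : 'Hom(U, W)) (g : 'Hom(V, W)) :
    'Hom((U * V)%type, W) :=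
  linfun (fun x : U * V => f x.1 + g x.2).

Lemma lfun_copairE (U V W : vectType F) (f : 'Hom(U, W)) (g : 'Hom(V, W)) x :
  lfun_copair f g x = f x.1 + g x.2.
Proof.
pose k (y : U * V) := f y.1 + g y.2.
have kl : linear k.
  by move=> a y z; rewrite /k /= !linearP scalerDr addrACA.
pose kL : {linear (U * V)%type -> W} := HB.pack k (GRing.isLinear.Build _ _ _ _ k kl).
exact: (lfunE kL).
Qed.

(** Sends the unit vector to [v] if [b] holds and is zero otherwise; passing through [bitmap] avoids
    a case distinction on the type. *)
Definition bit_vec (V : vectType F) (b : bool) (v : V) : 'Hom('rV[F]_b, V) :=
  linfun (fun x : 'rV[F]_b => bitmap F b true x ord0 ord0 *: v).

Lemma bit_vecE (V : vectType F) (b : bool) (v : V) x :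
  bit_vec b v x = bitmap F b true x ord0 ord0 *: v.
Proof.
pose k (x : 'rV[F]_b) := bitmap F b true x ord0 ord0 *: v.
have kl : linear k.
  by move=> a y z; rewrite /k /= linearP !mxE scalerDl scalerA.
pose kL : {linear 'rV[F]_b -> V} := HB.pack k (GRing.isLinear.Build _ _ _ _ k kl).
exact: (lfunE kL).
Qed.

Lemma bit_vec0 (V : vectType F) (b : bool) (v : V) x : ~~ b -> bit_vec b v x = 0.
Proof. by move=> b0; rewrite bit_vecE bitmap0 ?(negPf b0) // mxE scale0r. Qed.

Lemma bit_vec_bitmap (V : vectType F) (b c : bool) (v : V) x : b ==> c ->
  bit_vec c v (bitmap F b c x) = bit_vec b v x.
Proof. by move=> bc; rewrite !bit_vecE bitmap_comp // andbT. Qed.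

Lemma limg_full_bij (V W : vectType F) (f : 'Hom(V, W)) :
  (forall w, w \in limg f) -> dim V = dim W -> cancel f f^-1%VF /\ cancel f^-1%VF f.
Proof.
move=> fV dVW; have fW : limg f = fullv.
  by apply/eqP; rewrite eqEsubv subvf; apply/subvP => w _.
split=> [|w]; last by rewrite limg_lfunVK.
apply: lker0_lfunK; rewrite -dimv_eq0 -(capfv (lker f)).
by have := limg_ker_dim f fullv; rewrite fW !dimvf -dVW -[RHS]add0n => /eqP; rewrite eqn_add2r.
Qed.

End LinearMaps.

Section Functors.
Variables (R : realType) (F : fieldType).
Local Notation T := {nonneg R}.

Definition natural_chmap (X Y : chfunctor R F) (f : forall t, chmap (X t) (Y t)) :=
  forall (s t : T) (h : s <= t) n x, f t n (ftr X h n x) = ftr Y h n (f s n x).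

(** A surjection between spaces of equal dimension is invertible, and the inverses commute with
    differentials and transitions. So only a map into [X] has to be built. *)
Lemma natural_bij_iso (X Y : chfunctor R F) (f : forall t, chmap (Y t) (X t)) :
    natural_chmap f -> (forall t n x, x \in limg (f t n)) ->
    (forall t n, dim (Y t n) = dim (X t n)) ->
  chfunctor_iso X Y.
Proof.
move=> nf fX dXY; have fK t n := limg_full_bij (fX t n) (dXY t n).
have gP t n : ((f t n)^-1 \o diff (X t) n = diff (Y t) n \o (f t n.+1)^-1)%VF.
  apply/lfunP=> x; rewrite !comp_lfunE /= -{1}((fK t n.+1).2 x) -cmapE.
  by rewrite (fK t n).1.
exists (fun t => ChMap (gP t)); split=> [s t h n x|t] /=.
  by rewrite -{1}((fK s n).2 x) -nf (fK t n).1.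
by exists (f t); split=> n; have [] := fK t n.
Qed.

Definition copair_cmap (C D E : chcomplex F) (f : chmap C E) (g : chmap D E) n :
  'Hom(sum2_ch C D n, E n) := lfun_copair (f n) (g n).

Lemma copair_cmapP C D E (f : chmap C E) (g : chmap D E) n :
  (copair_cmap f g n \o diff (sum2_ch C D) n = diff E n \o copair_cmap f g n.+1)%VF.
Proof.
by apply/lfunP=> x; rewrite !comp_lfunE !lfun_copairE lfun_pairE linearD /= !cmapE.
Qed.

Definition copair_chmap C D E (f : chmap C E) (g : chmap D E) := ChMap (copair_cmapP f g).

Lemma zero_cmapP (C D : chcomplex F) n :
  ((0 : 'Hom(C n, D n)) \o diff C n = diff D n \o 0)%VF.
Proof. by apply/lfunP=> x; rewrite !comp_lfunE !zero_lfunE linear0. Qed.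

Definition zero_chmap C D : chmap C D := ChMap (zero_cmapP C D).

Lemma dim_isphere (b : bar R) t n : dim (interval_sphere F b t n) = isphere_bit b t n.
Proof. by rewrite /dim /= mul1n. Qed.

(** * Morphisms out of a single interval sphere *)

Section SphereMap.
Variables (X : chfunctor R F) (b : bar R) (v : forall t n, X t n).
Hypothesis vtr : forall s t (h : s <= t) n, isphere_bit b s n -> ftr X h n (v s n) = v t n.
Hypothesis vdiff : forall t n, isphere_bit b t n.+1 ->
  diff (X t) n (v t n.+1) = if isphere_bit b t n then v t n else 0.

Definition sphere_cmap t n : 'Hom(isphere_ch F b t n, X t n) :=
  bit_vec (isphere_bit b t n) (v t n).

Lemma sphere_cmapP t n : (sphere_cmap t n \o diff (isphere_ch F b t) n =
  diff (X t) n \o sphere_cmap t n.+1)%VF.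
Proof.
apply/lfunP=> x; rewrite !comp_lfunE /=.
(* The bit occurs in the type of [x], so its value is recorded as a hypothesis instead of being
   substituted. *)
case: (orP (orbN (isphere_bit b t n.+1))) => b1; last first.
  by rewrite [X in diff _ _ X]bit_vec0 // linear0 /isphere_diff bitmap0 ?(negPf b1) ?linear0.
rewrite [X in diff _ _ X]bit_vecE linearZ /= vdiff //.
case: (orP (orbN (isphere_bit b t n))) => b0; last by rewrite bit_vec0 // ifN // scaler0.
by rewrite ifT // -bit_vecE; apply: bit_vec_bitmap; rewrite b0 implybT.
Qed.

Definition sphere_chmap t : chmap (interval_sphere F b t) (X t) := ChMap (sphere_cmapP t).

Lemma sphere_chmap_natural : natural_chmap sphere_chmap.
Proof.
move=> s t h n x /=; case: (orP (orbN (isphere_bit b s n))) => b1; last first.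
  by rewrite [X in ftr _ _ _ X]bit_vec0 // linear0 /isphere_cmap bitmap0 ?(negPf b1) ?linear0.
rewrite [X in ftr _ _ _ X]bit_vecE linearZ /= vtr // -bit_vecE.
by apply: bit_vec_bitmap; rewrite (isphere_bit_le h b1) implybT.
Qed.

Lemma sphere_chmap_img t n : isphere_bit b t n -> v t n \in limg (sphere_chmap t n).
Proof.
move=> bt; apply/memv_imgP.
exists (bitmap F true (isphere_bit b t n) (const_mx 1)); first exact: memvf.
by rewrite bit_vecE bitmap_comp ?bt // bitmap_id mxE scale1r.
Qed.

End SphereMap.

(** * Assembling spheres from a basis in which the differential is a matching *)

Section SphereSum.
Variables (X : chfunctor R F) (m : nat) (deg : 'I_m -> nat) (ent : 'I_m -> T).
Variables (Y : 'I_m -> forall t n, X t n) (N : 'M[F]_m).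
Hypothesis Ytr : forall k (s t : T) (h : s <= t) n, ent k <= s ->
  ftr X h n (Y k s n) = Y k t n.
Hypothesis Ydiff : forall k t n, ent k <= t ->
  diff (X t) n (Y k t n.+1) = \sum_h N h k *: Y h t n.
Hypothesis Nbnd : boundary_mx deg ent N.

Local Notation barq := (bar_of deg ent).

(** Values in degrees where the sphere is zero are arbitrary: [sphere_cmap] kills them. *)
Definition sphere_val (q : 'I_m * option 'I_m) t n : X t n :=
  if n == deg q.1 then Y q.1 t n else if q.2 is Some j then Y j t n else 0.

(* With respect to Y, the indices of q span an interval sphere. *)
Definition paired (q : 'I_m * option 'I_m) : Prop :=
  (forall h, N h q.1 = 0) /\
  (if q.2 is Some j then forall h, N h j = (h == q.1)%:R else True).

Lemma paired_Some i j : paired (i, Some j) -> (deg i).+1 = deg j /\ ent i <= ent j.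
Proof. by case=> _ /= /(_ i) e; apply: Nbnd; rewrite e eqxx oner_neq0. Qed.

(** The paired indices have consecutive degrees, so at most one summand is 1. This lets dimensions
    be compared with the basis [Y] by counting indices. *)
Lemma isphere_bit_bar q t n : paired q ->
  isphere_bit (barq q) t n = (\sum_(k <- indices q) (deg k == n) && (ent k <= t)%O)%N :> nat.
Proof.
case: q => i [j|] pq; rewrite /isphere_bit /indices /= ![n == _]eq_sym; last first.
  by rewrite big_seq1 andbF orbF.
have [dj lij] := paired_Some pq; rewrite big_cons big_seq1 -dj.
have [<-|_] := eqVneq (deg i) n; first by rewrite [_.+1 == _]gtn_eqF //= orbF addn0.
case: (_.+1 == n) => //=; rewrite add0n; congr nat_of_bool.
by have [jt|] := boolP (ent j <= t); [rewrite (le_trans lij jt) | rewrite andbF].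
Qed.

Lemma sphere_val_tr q s t (h : s <= t) n : paired q -> isphere_bit (barq q) s n ->
  ftr X h n (sphere_val q s n) = sphere_val q t n.
Proof.
move=> pq; rewrite /isphere_bit /sphere_val; case: eqP => /= [_|_].
  by move=> bs; apply: Ytr; case/orP: bs => // /andP[/andP[_ ->]].
by case: q pq => i [j|] pq /= /andP[_ bs]; [apply: Ytr | rewrite linear0].
Qed.

Lemma sphere_val_diff q t n : paired q -> isphere_bit (barq q) t n.+1 ->
  diff (X t) n (sphere_val q t n.+1) =
  if isphere_bit (barq q) t n then sphere_val q t n else 0.
Proof.
case: q => i o [/= Ni No]; rewrite /isphere_bit /sphere_val /=.
have [<- /=|_ /=] := eqVneq n.+1 (deg i).
  rewrite [n == _]ltn_eqF // [n == _]ltn_eqF 1?ltnW //= => bs.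
  rewrite Ydiff; last by case/orP: bs => // /andP[/andP[_ ->]].
  by rewrite big1 // => h _; rewrite Ni scale0r.
rewrite eqSS => /andP[/andP[/eqP-> it] jt]; rewrite eqxx it /=.
case: o No jt => [j|] //= Nj jt; rewrite Ydiff // (bigD1 i) //= Nj eqxx scale1r.
by rewrite big1 ?addr0 // => h hi; rewrite Nj (negPf hi) scale0r.
Qed.

Lemma sphere_val_img q t k : paired q -> k \in indices q ->
  sphere_val q t (deg k) = Y k t (deg k).
Proof.
case: q => i [j|] pq; rewrite /sphere_val /indices /= !inE; last by move/eqP->; rewrite eqxx.
case/orP=> /eqP->; first by rewrite eqxx.
by have [<- _] := paired_Some pq; rewrite gtn_eqF.
Qed.

(** Collects, by induction on the spheres, the naturality, image and dimension statements that
    [natural_bij_iso] asks for. *)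
Lemma sphere_sum_map (qs : seq ('I_m * option 'I_m)) : (forall q, q \in qs -> paired q) ->
  exists f : forall t, chmap (sum_functor [seq interval_sphere F (barq q) | q <- qs] t) (X t),
    [/\ natural_chmap f,
      forall t k, k \in flatten [seq indices q | q <- qs] -> ent k <= t ->
        Y k t (deg k) \in limg (f t (deg k))
    & forall t n, dim (sum_functor [seq interval_sphere F (barq q) | q <- qs] t n) =
        (\sum_(k <- flatten [seq indices q | q <- qs]) (deg k == n) && (ent k <= t)%O)%N].
Proof.
elim: qs => [|q qs IHqs] qsP.
  exists (fun t => zero_chmap _ _); split=> //= [s t h n x|t n]; last by rewrite big_nil.
  by rewrite !zero_lfunE linear0.
have pq : paired q by apply: qsP; rewrite mem_head.
have [r rqs|g [gnat gimg gdim]] := IHqs; first by apply: qsP; rewrite inE rqs orbT.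
pose f := sphere_chmap (v := sphere_val q) (fun t n => @sphere_val_diff q t n pq).
have fnat : natural_chmap f by apply: sphere_chmap_natural => s t h n; apply: sphere_val_tr.
exists (fun t => copair_chmap (f t) (g t)); split=> [s t h n x|t k|t n] /=.
- by rewrite /copair_cmap !lfun_copairE lfun_pairE linearD /= fnat gnat.
- rewrite mem_cat => kq kt.
  suff : Y k t (deg k) \in limg (f t (deg k)) \/ Y k t (deg k) \in limg (g t (deg k)).
    rewrite /copair_cmap; case=> /memv_imgP[z _ ->]; apply/memv_imgP.
      by exists (z, 0); rewrite ?memvf // lfun_copairE linear0 addr0.
    by exists (0, z); rewrite ?memvf // lfun_copairE linear0 add0r.
  case/orP: kq => kq; [left | right]; last exact: gimg.
  rewrite -(sphere_val_img t pq kq); apply: sphere_chmap_img.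
  suff : (0 < isphere_bit (barq q) t (deg k))%N by case: isphere_bit.
  by rewrite isphere_bit_bar // (big_rem k) //= eqxx kt.
- rewrite big_cat /= -gdim -isphere_bit_bar // -(dim_isphere (barq q)).
  by [].
Qed.

Hypothesis Ybasis : forall t n, basis_of fullv
  [seq Y k t n | k <- [seq k <- enum 'I_m | (deg k == n) && (ent k <= t)]].

(** Every index occurs in exactly one member of [qs], so each column of [N] is zero or a unit vector
    and every member is [paired]. *)
Lemma sphere_sum_iso (qs : seq ('I_m * option 'I_m)) :
    (forall k h, N k h = ((k, Some h) \in qs)%:R) ->
    perm_eq (flatten [seq indices q | q <- qs]) (enum 'I_m) ->
  chfunctor_iso X (sum_functor [seq interval_sphere F b | b <- map barq qs]).
Proof.
move=> Nqs perm_qs.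
have uqs : uniq (flatten [seq indices q | q <- qs]) by rewrite (perm_uniq perm_qs) enum_uniq.
have sep q r k : q \in qs -> r \in qs -> k \in indices q -> k \in indices r -> q = r.
  elim: qs uqs {Nqs perm_qs} => //= q0 qs IHqs.
  rewrite cat_uniq !inE => /and3P[_ /hasPn no uqs] /predU1P[->|qqs] /predU1P[->|rqs] // kq kr.
  - have /no/negP[] // : k \in flatten [seq indices q | q <- qs].
    by apply/flattenP; exists (indices r); rewrite ?map_f.
  - have /no/negP[] // : k \in flatten [seq indices q | q <- qs].
    by apply/flattenP; exists (indices q); rewrite ?map_f.
  - exact: IHqs.
have Nii i : N i i = 0.
  by apply/eqP; apply: contraT => /Nbnd[] /eqP; rewrite gtn_eqF.
have qsP q : q \in qs -> paired q.
  case: q => i o iqs; split=> /= [h|].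
    (* A nonzero entry [N h i] would place [i] in the pair [(h, Some i)], which [sep] identifies
       with [(i, o)]; then [N i i] would be nonzero. *)
    rewrite Nqs; case: (boolP (_ \in _)) => // hqs.
    have [hi oi] : (h, Some i) = (i, o).
      by apply: (sep _ _ i) => //; rewrite /indices /= ?inE ?eqxx ?orbT //; case: (o) => *;
        rewrite mem_head.
    by move: hqs; rewrite hi; have := Nqs i i; rewrite Nii;
      case: (_ \in _) => // /esym/eqP; rewrite oner_eq0.
  case: o iqs => // j jqs h; rewrite Nqs; congr _%:R; congr nat_of_bool.
  apply/idP/eqP => [hqs|->//].
  by have [] : (h, Some j) = (i, Some j) by apply: (sep _ _ j) => //;
    rewrite /indices !inE eqxx orbT.
have [f [fnat fimg fdim]] := sphere_sum_map qsP.
rewrite -map_comp; apply: natural_bij_iso fnat _ _ => t n; last first.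
  have /andP[/eqP Ysp /eqP Yfree] := Ybasis t n.
  rewrite fdim (perm_big _ perm_qs) /= -[RHS]dimvf -Ysp Yfree size_map size_filter -sum1_count.
  by rewrite [RHS]big_mkcond; apply: eq_bigr => k _; case: (_ && _).
move=> x; have /andP[/eqP Ysp _] := Ybasis t n.
suff sp : (fullv <= limg (f t n))%VS by apply: (subvP sp); apply: memvf.
rewrite -Ysp; apply/span_subvP => _ /mapP[k kn ->].
move: kn; rewrite mem_filter => /andP[/andP[/eqP <- kt] _]; apply: fimg => //.
by rewrite (perm_mem perm_qs) mem_enum.
Qed.

End SphereSum.

End Functors.

(** * Homology *)

Section Homology.
Variables (R : realType) (F : fieldType) (n : nat).
Local Notation T := {nonneg R}.
Implicit Types (X Y : chfunctor R F) (M : persmod R F).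

Lemma mem_boundaries (C : chcomplex F) (z : subvs_of (cycles C n)) :
  (z \in boundaries C n) <-> exists w, vsval z = diff C n w.
Proof.
rewrite -memv_preim (_ : linfun vsval z = vsval z); last exact: lfunE.
by split=> [/memv_imgP[w _ ->]|[w ->]]; [exists w | rewrite memv_img ?memvf].
Qed.

(* The data of an isomorphism H_n X = M, expressed on cycles. *)
Definition represents X M : Prop := exists g : forall t, 'Hom(X t n, M t),
  [/\ forall (s t : T) (h : s <= t) x, x \in cycles (X s) n ->
        g t (ftr X h n x) = ptr M h (g s x),
      forall t y, exists2 x, x \in cycles (X t) n & g t x = y
    & forall t x, x \in cycles (X t) n -> g t x = 0 <-> exists w, x = diff (X t) n w].

(** The kernel condition makes [g] both well defined and injective on homology classes. What follows
    can then work with cycles alone. *)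
Lemma represents_iso X M : represents X M -> persmod_iso (homology_functor X n) M.
Proof.
case=> g [gnat gsur gker].
pose k t (q : homology (X t) n) := g t (vsval (class_repr q)).
have kE t z : k t (class _ z) = g t (vsval z).
  apply/eqP; rewrite /k -subr_eq0 -linearB -(linearB vsval); apply/eqP/(gker t _ (subvsP _)).
  by apply/mem_boundaries/classP; rewrite class_reprK.
have kl t : linear (k t).
  move=> a q r; rewrite -(class_reprK q) -(class_reprK r) -linearP !kE.
  by rewrite [vsval _]linearP linearP.
pose kL t : {linear homology (X t) n -> M t} :=
  HB.pack (k t) (GRing.isLinear.Build _ _ _ _ (k t) (kl t)).
have fE t q : linfun (kL t) q = k t q by rewrite lfunE.
exists (fun t => linfun (kL t)); split=> [s t h q|t].
  rewrite !fE -{1}(class_reprK q) /= homology_mapE kE cycles_mapE.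
  by rewrite gnat ?subvsP.
have fK : lker (linfun (kL t)) == 0%VS.
  rewrite -subv0; apply/subvP => q; rewrite memv_ker memv0 fE => /eqP.
  rewrite -(class_reprK q) kE => /(gker t _ (subvsP _)) [w e].
  apply/eqP; rewrite -(linear0 (class (boundaries (X t) n))); apply/classP.
  by rewrite subr0; apply/mem_boundaries; exists w.
exists (linfun (kL t))^-1%VF => [|y]; first exact: (lker0_lfunK fK).
apply: limg_lfunVK; have [x xc <-] := gsur t y; apply/memv_imgP.
by exists (class _ (Subvs xc)); rewrite ?memvf // fE kE.
Qed.

Lemma chmap_cycles (C D : chcomplex F) (f : chmap C D) x : x \in cycles C n ->
  f n x \in cycles D n.
Proof.
case: n f x => [|m] f x /=; first by rewrite !memvf.
by rewrite !memv_ker -cmapE => /eqP->; rewrite linear0.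
Qed.

Lemma represents_chfunctor_iso X Y M : chfunctor_iso X Y -> represents Y M -> represents X M.
Proof.
case=> f [fnat fiso] [g [gnat gsur gker]].
exists (fun t => g t \o f t n)%VF; split=> [s t h x xc|t y|t x xc].
- by rewrite !comp_lfunE fnat gnat // chmap_cycles.
- have [f' [fK f'K]] := fiso t; have [x xc xy] := gsur t y.
  by exists (f' n x); [exact: chmap_cycles | rewrite comp_lfunE f'K].
- rewrite comp_lfunE gker ?chmap_cycles //; split=> -[w e]; last first.
    by exists (f t n.+1 w); rewrite e cmapE.
  have [f' [fK f'K]] := fiso t; exists (f' n.+1 w).
  by apply: (can_inj (fK n)); rewrite e cmapE f'K.
Qed.

Lemma mem_cycles_sum2 (C D : chcomplex F) (x : sum2_ch C D n) :
  (x \in cycles (sum2_ch C D) n) = (x.1 \in cycles C n) && (x.2 \in cycles D n).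
Proof.
case: n x => [|m] x /=; first by rewrite !memvf.
by rewrite !memv_ker [sum2_diff _ _ _ _]lfun_pairE.
Qed.

Lemma represents_sum2 X Y M N : represents X M -> represents Y N ->
  represents (sum2_functor X Y) (sum2_persmod M N).
Proof.
move=> [f [fnat fsur fker]] [g [gnat gsur gker]].
exists (fun t => lfun_pair (f t) (g t)); split=> [s t h x|t [y z]|t x].
- rewrite mem_cycles_sum2 => /andP[x1 x2] /=.
  by rewrite /sum2_cmap !lfun_pairE /= fnat // gnat.
- have [x xc <-] := fsur t y; have [x' xc' <-] := gsur t z.
  by exists (x, x'); [rewrite mem_cycles_sum2 xc | rewrite lfun_pairE].
- rewrite mem_cycles_sum2 lfun_pairE => /andP[/(fker t) fx /(gker t) gx]; split.
    case=> /fx[w e] /gx[w' e']; exists (w, w').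
    by rewrite /= /sum2_diff lfun_pairE -e -e' -surjective_pairing.
  case=> w; rewrite /= /sum2_diff lfun_pairE => e.
  by congr pair; [apply/fx; exists w.1 | apply/gx; exists w.2]; rewrite e.
Qed.

Definition acyclic X := forall t x, x \in cycles (X t) n -> exists w, x = diff (X t) n w.

(** The barcode omits the spheres without homology in degree [n] altogether, so these must be
    absorbed without adding a zero summand. *)
Lemma represents_acyclic_sum2 X Y M : acyclic X -> represents Y M ->
  represents (sum2_functor X Y) M.
Proof.
move=> aX [g [gnat gsur gker]].
exists (fun t => lfun_copair (0 : 'Hom(X t n, M t)) (g t)); split=> [s t h x|t y|t x].
- rewrite mem_cycles_sum2 => /andP[x1 x2] /=.
  by rewrite /sum2_cmap !lfun_copairE lfun_pairE !zero_lfunE !add0r gnat.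
- have [x xc <-] := gsur t y; exists (0, x); first by rewrite mem_cycles_sum2 mem0v.
  by rewrite lfun_copairE zero_lfunE add0r.
- rewrite mem_cycles_sum2 lfun_copairE zero_lfunE add0r => /andP[/aX[w e] /(gker t) gx].
  rewrite gx; split=> [[w' e']|[w']]; last first.
    by rewrite /= /sum2_diff lfun_pairE => e'; exists w'.2; rewrite e'.
  by exists (w, w'); rewrite /= /sum2_diff lfun_pairE -e -e' -surjective_pairing.
Qed.

Lemma represents_zero : represents (zero_functor R F) (zero_persmod R F).
Proof.
exists (fun t => \1%VF); split=> [s t h x _|t y|t x _] /=.
- by rewrite !id_lfunE.
- by exists y; rewrite ?id_lfunE // [y]thinmx0 mem0v.
- by rewrite [x]thinmx0; split=> _; [exists 0; rewrite linear0 | rewrite linear0].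
Qed.

Lemma isphere_cycles (b : bar R) t (x : interval_sphere F b t n) : bdeg b = n ->
  x \in cycles (interval_sphere F b t) n.
Proof.
case: n x => [|p] x bp; first exact: memvf.
rewrite memv_ker; apply/eqP; apply: bitmap0; rewrite negb_and; apply/orP; right.
by apply/negP => /isphere_bit_deg; rewrite bp ltn_eqF // ltn_eqF // ltnS leqnSn.
Qed.

Lemma isphere_boundary (b : bar R) t (x : interval_sphere F b t n) :
  (isphere_bit b t n ==> isphere_bit b t n.+1) -> exists w, x = diff (interval_sphere F b t) n w.
Proof.
move=> bb; exists (bitmap F (isphere_bit b t n) (isphere_bit b t n.+1) x).
rewrite -[LHS]bitmap_id; apply/esym; apply: bitmap_comp.
by rewrite andbb.
Qed.

(** In degree [n] all elements are cycles. Before the endpoint there are no nonzero boundaries; from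
    the endpoint on everything is a boundary and the interval module is 0. *)
Lemma represents_isphere (b : bar R) : bdeg b = n ->
  represents (interval_sphere F b) (interval_module F b).
Proof.
move=> bn; have bit0 t : isphere_bit b t n = (bstart b <= t).
  by rewrite /isphere_bit bn eqxx [n == _]ltn_eqF //= orbF.
have bit1 t : isphere_bit b t n.+1 = (bstart b <= t) && ended (bend b) t.
  by rewrite /isphere_bit bn eqxx [_.+1 == _]gtn_eqF.
exists (fun t => bitmap F (isphere_bit b t n) (imod_bit b t)); split=> [s t h x _|t y|t x _].
- transitivity (bitmap F (isphere_bit b s n) (imod_bit b t) x).
    by apply: bitmap_comp; rewrite !bit0; apply/implyP => /andP[bs _]; apply: le_trans h.
  apply/esym; apply: bitmap_comp; apply/implyP; rewrite bit0 => /andP[bs /andP[_ et]].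
  rewrite /imod_bit bs /=; apply: contra et; rewrite /ended; case: (bend b) => // e es.
  exact: le_trans h.
- exists (bitmap F (imod_bit b t) (isphere_bit b t n) y); first exact: isphere_cycles.
  rewrite -[RHS]bitmap_id; apply: bitmap_comp.
  by rewrite andbb bit0; apply/implyP => /andP[].
- have [it|it] := orP (orbN (imod_bit b t)); split=> [gx|[w xw]].
  + exists 0; rewrite linear0; have [bt et] := andP it.
    rewrite -[LHS]bitmap_id -(@bitmap_comp _ _ (imod_bit b t)); last by rewrite it implybT.
    by rewrite [bitmap _ _ _ x]gx linear0.
  + rewrite xw; suff -> : w = 0 by rewrite !linear0.
    rewrite -[LHS]bitmap_id bitmap0 // andbb bit1 negb_and.
    by have [_ ->] := andP it; rewrite orbT.
  + apply: isphere_boundary; rewrite bit0 bit1; apply/implyP => bt; rewrite bt /=.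
    by move: it; rewrite /imod_bit bt negbK.
  + by rewrite bitmap0 // negb_and it orbT.
Qed.

(** For [bdeg b = n] the interval is empty, so a class is killed as soon as it appears. Otherwise
    only degree [(bdeg b).+1] can carry anything, and there the differential is injective. *)
Lemma acyclic_isphere (b : bar R) : ~~ ((bdeg b == n) && lt_end (bstart b) (bend b)) ->
  acyclic (interval_sphere F b).
Proof.
move=> nb t x xc; have [bn|/negPf bn] := eqVneq (bdeg b) n.
  move: nb; rewrite bn eqxx /= => se; apply: isphere_boundary.
  rewrite /isphere_bit bn eqxx [n == _]ltn_eqF //= orbF gtn_eqF //=.
  apply/implyP => bt; rewrite bt /=.
  by case: (bend b) se => // e; rewrite -leNgt => es; rewrite eqxx; apply: le_trans es bt.
exists 0; rewrite linear0 -[LHS]bitmap_id.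
case: (orP (orbN (isphere_bit b t n))) => bt; last by rewrite bitmap0 ?andbb.
have /andP[/eqP nS st] : (n == (bdeg b).+1) && (bstart b <= t).
  by move: bt; rewrite /isphere_bit [n == bdeg b]eq_sym bn => /andP[].
move: x xc bt; rewrite nS => x; rewrite memv_ker => /eqP dx bt.
have b0 : isphere_bit b t (bdeg b) by rewrite /isphere_bit eqxx st.
rewrite -(@bitmap_comp _ _ (isphere_bit b t (bdeg b))); last by rewrite b0 implybT.
by rewrite [bitmap _ _ _ x]dx linear0.
Qed.

Lemma represents_sum (L : seq (bar R)) :
  represents (sum_functor [seq interval_sphere F b | b <- L])
    (sum_persmod [seq interval_module F b
                 | b <- L & (bdeg b == n) && lt_end (bstart b) (bend b)]).
Proof.
elim: L => [|b L IHL] /=; first exact: represents_zero.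
case: ifPn => [/andP[/eqP bn _]|nb] /=.
  by apply: represents_sum2 => //; apply: represents_isphere.
by apply: represents_acyclic_sum2 => //; apply: acyclic_isphere.
Qed.

End Homology.

(** * From matrices back to the filtered complex *)

Section Correctness.
Variables (R : realType) (F : fieldType) (X : chfunctor R F).
Hypothesis fX : filtered X.
Variable G : generators X.
Hypothesis qmin : quasi_minimal G.
Local Notation m := (gsize G).
Local Notation gdeg := (gdeg (g := G)).
Local Notation gent := (gent (g := G)).
Variable D : 'M[F]_m.
Hypothesis DP : boundary_matrix (G := G) D.

Section ChangeOfBasis.
Variables P N : 'M[F]_m.
Hypotheses (Punit : P \in unitmx) (Pfilt : filtered_mx gdeg gent P).
Hypothesis DPN : D *m P = P *m N.

Definition new_gen (k : 'I_m) t n : X t n := \sum_i P i k *: gen_at i t n.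

Lemma new_gen_tr k (s t : {nonneg R}) (h : s <= t) n : gent k <= s ->
  ftr X h n (new_gen k s n) = new_gen k t n.
Proof.
move=> ks; rewrite linear_sum; apply: eq_bigr => i _; rewrite linearZ /=.
have [->|/Pfilt[_ ik]] := eqVneq (P i k) 0; first by rewrite !scale0r.
by rewrite gen_at_tr // (le_trans ik).
Qed.

Lemma new_gen_diff k t n : gent k <= t ->
  diff (X t) n (new_gen k t n.+1) = \sum_h N h k *: new_gen h t n.
Proof.
move=> kt; transitivity (\sum_h (D *m P) h k *: gen_at h t n).
  rewrite linear_sum; under [RHS]eq_bigr do rewrite mxE scaler_suml.
  rewrite exchange_big; apply: eq_bigr => i _; rewrite linearZ /=.
  have [->|/Pfilt[_ ik]] := eqVneq (P i k) 0.
    by rewrite scale0r big1 // => h _; rewrite mulr0 scale0r.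
  rewrite (diff_gen_at DP) ?(le_trans ik) // scaler_sumr.
  by apply: eq_bigr => h _; rewrite scalerA mulrC.
rewrite DPN; under [LHS]eq_bigr do rewrite mxE scaler_suml.
rewrite exchange_big; apply: eq_bigr => h _; rewrite scaler_sumr.
by apply: eq_bigr => i _; rewrite scalerA mulrC.
Qed.

(** Independence suffices, the number of vectors being that of the old basis. A relation, extended
    by 0 to a column [u], gives [P *m u = 0]. *)
Lemma new_gen_basis t n : basis_of fullv [seq new_gen k t n | k <- alives G t n].
Proof.
have free_new : free [seq new_gen k t n | k <- alives G t n].
  apply/free_mapP => [|c c0]; first exact: alives_uniq.
  pose u : 'cV[F]_m := \col_k (if alive t n k then c k else 0).
  suff u0 : u = 0.
    by move=> k; rewrite mem_alives => ak; move/colP/(_ k): u0; rewrite !mxE ak.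
  apply: (can_inj (mulKmx Punit)); rewrite mulmx0; apply/colP => i; rewrite [RHS]mxE.
  (* For [i] not alive the coordinate vanishes because [P] is filtered: a nonzero [P i k] with [k]
     alive would make [i] alive. *)
  have [ai|ai] := boolP (alive t n i); last first.
    rewrite mxE big1 // => k _; rewrite mxE; case: ifP => ak; last by rewrite mulr0.
    have [->|/Pfilt[dik ik]] := eqVneq (P i k) 0; first by rewrite mul0r.
    case/negP: ai; move: ak; rewrite /alive -dik => /andP[-> kt]; exact: le_trans ik kt.
  apply: (gen_at_indep fX qmin (c := fun i => (P *m u) i 0)) ai.
  rewrite -[RHS]c0; under eq_bigr do rewrite mxE scaler_suml.
  rewrite exchange_big /= big_filter big_enum_cond [RHS]big_mkcond; apply: eq_bigr => k _ /=.
  rewrite /new_gen; under eq_bigr do rewrite mxE.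
  case: ifP => _; last by rewrite big1 // => j _; rewrite mulr0 scale0r.
  by rewrite scaler_sumr; apply: eq_bigr => j _; rewrite scalerA mulrC.
have /andP[/eqP gen_span /eqP] := gen_at_basis fX qmin t n.
by rewrite gen_span basisEfree free_new subvf => ->; rewrite !size_map /=.
Qed.

End ChangeOfBasis.

Lemma complete_decomposition L P N qs : complete gdeg gent D L P N qs ->
  sphere_decomposition X L /\ barcode_decomposition X L.
Proof.
case=> Pu Pf DPN bN Nqs pqs ->.
have iso : chfunctor_iso X (sum_functor [seq interval_sphere F b | b <- map (bar_of gdeg gent) qs]).
  apply: (sphere_sum_iso (new_gen_tr Pf) (new_gen_diff Pf DPN) bN _ Nqs pqs).
  exact: new_gen_basis.
split; last first.
  by move=> n; apply/represents_iso/(represents_chfunctor_iso iso)/represents_sum.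
split=> //; rewrite all_map; apply/allP => -[i [j|//]] iq /=.
(* A pair is a nonzero entry of [N], so its interval has its start no later than its end. *)
by case: (bN i j) => //; rewrite Nqs iq oner_neq0.
Qed.

Lemma boundary_mxP : boundary_mx gdeg gent D.
Proof. by move=> i j /(DP j).1/andP[/eqP]. Qed.

Lemma algorithm_correct :
  [/\ terminates gdeg gent (start R D), never_stuck gdeg gent (start R D)
    & forall L, returns gdeg gent (start R D) L ->
        sphere_decomposition X L /\ barcode_decomposition X L].
Proof.
have DD := boundary_matrix_sqr fX qmin DP.
have inv : run_invariant gdeg gent D (start R D).
  by do 3!eexists; apply: partial_start boundary_mxP.
split.
- exact: run_invariant_terminates inv.
- by move=> c' /(run_invariant_reachable DD)/(_ inv)/run_invariant_progress.
- by move=> L /(run_invariant_reachable DD)/(_ inv)[P [N [qs /complete_decomposition]]].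
Qed.

End Correctness.

Theorem mainTheorem2 (R : realType) (p : nat) (hp : prime p)
    (X : chfunctor R 'F_p) (hX : filtered X)
    (G : generators X) (hG : generates G) (hmin : quasi_minimal G) :
  (exists! d : 'M['F_p]_(gsize G), boundary_matrix d) /\
  forall d : 'M['F_p]_(gsize G), boundary_matrix d ->
    [/\ terminates (gdeg (g := G)) (gent (g := G)) (start R d),
        never_stuck (gdeg (g := G)) (gent (g := G)) (start R d)
      & forall L : seq (bar R),
          returns (gdeg (g := G)) (gent (g := G)) (start R d) L ->
          sphere_decomposition X L /\ barcode_decomposition X L].
Proof.
split; first exact (boundary_matrix_exists hX hmin).
by move=> d dP; apply: (algorithm_correct hX hmin dP).
Qed.
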